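(* The triple $(\Gamma^{(m)}(B_n)_\lambda, C_{2mn+2}, \mu_\lambda(q))$ exhibits the cyclic sieving phenomenon.
   Context: Let $m \geq 1$ and $n \geq 1$ be integers. Let $\Gamma^{(m)}(B_n)$ be the $m$-cluster complex (generalized cluster complex of Fomin and Reading) of type $B_n$, i.e. the flag complex of the compatibility relation on the $m$-colored almost positive roots of $B_n$. Combinatorially it is the complex of $m$-divisible centrally symmetric dissections of the $(2mn+2)$-gon: a type $B_n$ diagonal is either a diameter or a centrally symmetric pair of diagonals, two such are compatible if they are noncrossing and only form $(mk+2)$-gons for integers $k$. The cyclic group $C_{2mn+2}$ acts on it via the Fomin–Reading rotation, which is the clockwise rotation of the $(2mn+2)$-gon. Each face $f$ has a parabolic type: the parabolic conjugacy class of the parabolic subgroup $W_{\underline{f}}$ of $B_n$ attached to $f$ (via the noncrossing partition $c_+(\prod f)c_-$). Parabolic types in $B_n$ are indexed by an integer partition $\lambda = [1^{n_1}, 2^{n_2}, \cdots, k^{n_k}] \vdash t \leq n$ describing the type $A$ irreducible components (a part $i$ corresponding to a component of type $A_{i-1}$, i.e. $\mathfrak{S}_i$), together with a type $B_{n-t}$ component; combinatorially, for a face $f$ with classical dissection partition $[1^{a_1}, \cdots, k^{a_k}]$, its type is $[1^{\lfloor a_1/2 \rfloor}, \cdots, k^{\lfloor a_k/2 \rfloor}]$. Let $\Gamma^{(m)}(B_n)_\lambda$ be the set of faces of parabolic type $\lambda$, and let $l = n_1 + \cdots + n_k$. Let $[a]_q = 1 + q + \cdots + q^{a-1}$ and let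 $\begin{bmatrix} \cdot \\ \cdot \end{bmatrix}_{q}$ denote $q$-multinomial coefficients. The polynomial $\mu_\lambda(q)$ is the $q$-analogue of the Douvropoulos–Josuat-Vergès counting formula: $\mu_\lambda(q) = \frac{\prod_{i=1}^l [2mn+2i]_q}{\prod_{j=1}^k \prod_{s=1}^{n_j} [2s]_q}$ (numerator from the exponents $1,3,\dots,2l-1$ of the intersection lattice $\Pi(B_n)_X \cong \Pi(B_l)$ shifted by $1+mh$ with $h=2n$, denominator from the degrees of $N(W_X)/W_X \cong B_{n_1} \times \cdots \times B_{n_k}$), which equals $\begin{bmatrix} mn+l \\ n_1, \cdots, n_k, mn \end{bmatrix}_{q^2}$. A triple $(X, C, P(q))$, with $C$ a finite cyclic group acting on a finite set $X$ and $P \in \mathbb{Z}[q]$, exhibits the cyclic sieving phenomenon if $P(e^{2i\pi/d}) = |X^g|$ for every $g \in C$ of order $d$. *)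

(* Defs.v *)
From mathcomp Require Import all_boot all_order all_fingroup all_algebra.
From mathcomp Require Import cyclic complex reals trigo.

Set Implicit Arguments.
Unset Strict Implicit.
Unset Printing Implicit Defensive.

Import GRing.Theory.

Local Open Scope ring_scope.

(* e^{2 i pi / d} *)
Definition unity_exp (R : realType) (d : nat) : R[i] :=
  (cos (2 * pi / d%:R) +i* sin (2 * pi / d%:R))%C.

Definition exhibits_CSP (R : realType) (gT : finGroupType) (T : finType)
    (to : {action gT &-> T}) (X : {set T}) (C : {group gT}) (P : {poly int}) :
    Prop :=
  [/\ cyclic C, [acts C, on X | to]%g &
      forall g : gT, g \in C ->
        (map_poly intr P).[unity_exp R #[g]%g] = #|('Fix_(X | to)[g])%g|%:R].

(* The vertices of the (2mn+2)-gon, numbered clockwise. The canonical group   *)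
(* law on this ordinal type is addition modulo 2mn+2: the type doubles as the *)
(* cyclic group C_{2mn+2}, acting on the vertices by translation.             *)
Notation vertex m n := 'I_(2 * m * n).+2.

Section Dissections.

Variables m n : nat.

Local Notation V := (vertex m n).

Implicit Types (x y z : V) (d e S : {set V}) (E : {set {set V}}).

(* The vertices met strictly between x and y when going clockwise from x. *)
Definition arc x y : {set V} :=
  [set z | (0 < (z - x)%R)%N & ((z - x)%R < (y - x)%R)%N].

Definition sides : {set {set V}} := [set [set x; x + 1] | x : V].

Definition diagonals : {set {set V}} :=
  [set d : {set V} | #|d| == 2 & d \notin sides].

Definition crossing d e : bool :=
  [exists x in d, exists y in d,
    (arc x y :&: e != set0) && (arc y x :&: e != set0)].

Definition noncrossing E : bool :=
  [forall d in E, forall e in E, ~~ crossing d e].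

Definition consecutive S x y : bool :=
  (arc x y :&: S == set0) || (arc y x :&: S == set0).

(* The polygons cut out by a noncrossing set E of diagonals, as vertex sets:  *)
(* the sides of such a polygon are sides of the big polygon or elements of E, *)
(* and none of its diagonals is in E.                                         *)
Definition cells E : {set {set V}} :=
  [set S : {set V} | (2 < #|S|)%N &
    [forall x in S, forall y in S, (x != y) ==>
      (consecutive S x y == ([set x; y] \in sides :|: E))]].

(* Every polygon cut out by E is an (mk+2)-gon for some integer k. *)
Definition m_divisible E : bool := [forall S in cells E, (m %| #|S| - 2)%N].

Definition antipode d : {set V} := [set x + (m * n).+1%:R | x in d].

(* [set d; antipode d] is a singleton exactly when d is a diameter. *)
Definition B_diagonals : {set {set {set V}}} :=
  [set [set d; antipode d] | d in diagonals].

Definition B_compatible (a b : {set {set V}}) : bool :=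
  noncrossing (a :|: b) && m_divisible (a :|: b).

(* Compatibility is also required for a = b: this says that a is a vertex of  *)
(* the complex, i.e. that a alone only forms (mk+2)-gons.                     *)
Definition m_cluster_complex : {set {set {set {set V}}}} :=
  [set f : {set {set {set V}}} | (f \subset B_diagonals) &&
    [forall a in f, forall b in f, B_compatible a b]].

(* a_j, the number of (mj+2)-gons in the dissection cover f underlying f *)
Definition dissection_mult (f : {set {set {set V}}}) (j : nat) : nat :=
  #|[set S in cells (cover f) | #|S| == (m * j + 2)%N]|.

(* The partition [1^(a_1 / 2), 2^(a_2 / 2), ...], as a nondecreasing          *)
(* sequence; no polygon of the dissection has more than m * (2 * n) + 2       *)
(* vertices.                                                                  *)
Definition parabolic_type (f : {set {set {set V}}}) : seq nat :=
  flatten [seq nseq (dissection_mult f j)./2 j | j <- iota 1 (2 * n)].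

Definition faces_of_type (lam : seq nat) : {set {set {set {set V}}}} :=
  [set f in m_cluster_complex | parabolic_type f == lam].

(* 'R is the translation action of the group V on itself; each ^* transports  *)
(* it to sets: diagonals, then type B diagonals, then sets of these.          *)
Definition rotation : {action V &-> {set {set {set V}}}} := ('R^*^*^*)%act.

End Dissections.

(* A partition is the nondecreasing sequence of its (positive) parts. *)
Definition is_partition (lam : seq nat) : bool :=
  sorted leq lam && (0%N \notin lam).

Definition qint (a : nat) : {poly int} := \sum_(i < a) 'X^i.

Definition mu_num (m n : nat) (lam : seq nat) : {poly int} :=
  \prod_(1 <= i < (size lam).+1) qint (2 * m * n + 2 * i).

Definition mu_den (lam : seq nat) : {poly int} :=
  \prod_(1 <= j < (\max_(i <- lam) i).+1)
    \prod_(1 <= s < (count_mem j lam).+1) qint (2 * s).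

(* The division is exact: see mu_denK. *)
Definition mu (m n : nat) (lam : seq nat) : {poly int} :=
  mu_num m n lam %/ mu_den lam.

Lemma qint_add a b : qint (a + b) = qint a + 'X^a * qint b.
Proof.
rewrite /qint big_split_ord /=; congr (_ + _).
by rewrite mulr_sumr; apply: eq_bigr => i _; rewrite exprD.
Qed.

Lemma monic_qint a : (0 < a)%N -> qint a \is monic.
Proof.
case: a => // a _; have -> : qint a.+1 = \poly_(i < a.+1) 1.
  by rewrite poly_def; apply: eq_bigr => i _; rewrite scale1r.
by rewrite monicE lead_coef_poly.
Qed.

Lemma monic_mu_den lam : mu_den lam \is monic.
Proof.
rewrite /mu_den; apply: monic_prod => j _; rewrite big_nat.
by apply: monic_prod => s /andP[s_gt0 _]; rewrite monic_qint // muln_gt0.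
Qed.

Lemma qbinom_exact N a :
  exists P, \prod_(1 <= i < a.+1) qint (2 * N + 2 * i) =
            P * \prod_(1 <= s < a.+1) qint (2 * s).
Proof.
elim: a N => [|a IHa] N; first by exists 1; rewrite !big_geq ?mulr1.
elim: N => [|N [P IHN]].
  by exists 1; rewrite mul1r; apply: eq_bigr => i _; rewrite muln0.
have [Q HQ] := IHa N.+1.
exists (Q + 'X^(2 * a.+1) * P).
rewrite mulrDl -mulrA -IHN big_nat_recr //= [X in qint X]addnC qint_add.
rewrite mulrDr; congr (_ + _).
  by rewrite HQ -mulrA; congr (_ * _); rewrite [RHS]big_nat_recr.
rewrite mulrCA; congr (_ * _); rewrite [RHS]big_nat_recl //= mulrC.
congr (_ * _); first by congr qint; rewrite muln1 mulnS addnC.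
by apply: eq_bigr => i _; congr qint; rewrite !mulnS addnA [(2 + _)%N]addnC.
Qed.

Lemma qmultinom_exact N (c : nat -> nat) K :
  exists P, \prod_(1 <= i < (\sum_(1 <= j < K.+1) c j).+1) qint (2 * N + 2 * i) =
            P * \prod_(1 <= j < K.+1) \prod_(1 <= s < (c j).+1) qint (2 * s).
Proof.
elim: K => [|K [P IH]]; first by exists 1; rewrite !(big_geq (m := 1)) ?mulr1.
set t := (\sum_(1 <= j < K.+1) c j)%N in IH.
have [Q HQ] := qbinom_exact (N + t) (c K.+1).
have -> : (\sum_(1 <= j < K.+2) c j = t + c K.+1)%N by rewrite big_nat_recr.
exists (P * Q).
rewrite (big_cat_nat (n := t.+1)) //= ?ltnS ?leq_addr // IH.
rewrite [X in _ = _ * X]big_nat_recr //= mulrACA; congr (_ * _).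
have -> : (t + c K.+1).+1 = ((c K.+1).+1 + t)%N by rewrite addnC addSn.
rewrite -HQ -[t.+1]add1n big_addn addnK; apply: eq_bigr => i _.
by congr qint; rewrite mulnDr mulnDr [(2 * i + _)%N]addnC addnA.
Qed.

Lemma size_count_mem (lam : seq nat) : is_partition lam ->
  size lam = (\sum_(1 <= j < (\max_(i <- lam) i).+1) count_mem j lam)%N.
Proof.
case/andP=> _ lam0; have -> : size lam = (\sum_(i <- lam) 1)%N by rewrite sum1_size.
transitivity (\sum_(i <- lam) \sum_(1 <= j < (\max_(i <- lam) i).+1) (i == j))%N.
  apply: eq_big_seq => i i_lam; rewrite (bigD1_seq i) ?iota_uniq //=.
    by rewrite eqxx big1 // => j; rewrite eq_sym => /negbTE ->.
  rewrite mem_index_iota ltnS; apply/andP; split; last exact: leq_bigmax_seq.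
  by rewrite lt0n; apply: contraNneq lam0 => <-.
rewrite exchange_big; apply: eq_bigr => j _ /=.
by rewrite -sum1_count [RHS]big_mkcond; apply: eq_bigr => i _ /=; case: (i == j).
Qed.

Lemma mu_denK m n lam : is_partition lam ->
  mu m n lam * mu_den lam = mu_num m n lam.
Proof.
move=> lamP; rewrite /mu.
have [P] := qmultinom_exact (m * n) (fun j => count_mem j lam) (\max_(i <- lam) i).
rewrite -size_count_mem // mulnA -/(mu_num m n lam) -/(mu_den lam) => ->.
by rewrite Pdiv.IdomainMonic.mulpK // monic_mu_den.
Qed.

(* Main.v *)
(** The faces fixed by a rotation g are the dissections that are invariant under
    the rotation by N = gcd(g, mn + 1) steps, because all faces are centrally
    symmetric.  Orient every diagonal of such a dissection so that the center
    of the polygon is not on its clockwise arc; the cells other than the central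
    one then correspond to these arcs, the cell below an arc having as many
    inner vertices as there are vertices whose smallest enclosing arc is the
    given one.  Call this number the weight of the arc.

    Cutting the polygon at a vertex of the central cell turns an N-periodic
    family of noncrossing arcs into a family of noncrossing intervals of
    [0, N], and every such family arises.  Removing the longest interval that
    ends at N yields the recursion
      F(N, c) = F(N - 1, c) + sum_w F(N, c - e_w)
    for the number F(N, c) of families with c_w intervals of weight w, whence
      F(N, c) N! prod_w c_w! = (N - sum_w w c_w) (N + sum_w c_w - 1)!.
    Counting pairs (fixed face, vertex of its central cell) in two ways removes
    the dependence on the cut.  On the algebraic side the square of
    e^(2 i pi / d), for d the order of g, is a primitive e-th root of unity with
    e = (mn + 1) / N, and the factors [e]_(q^2) cancel in mu. *)

Require Import Defs.
From mathcomp Require Import all_boot all_order all_fingroup all_algebra reals.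
From mathcomp Require Import cyclic complex trigo zify.
Import Defs.

Set Implicit Arguments.
Unset Strict Implicit.
Unset Printing Implicit Defensive.

Import GRing.Theory.

(** Compatibility is a condition on pairs, so divisibility is imposed on the cells of two type B
    diagonals, while the type is read off the cells of the whole dissection. Arc lengths reconcile
    the two: all cells are (mk+2)-gons exactly when every arc has length congruent to 1 modulo m, a
    condition on one diagonal at a time.

    Noncentral cells come in antipodal pairs, so halving the multiplicities discards precisely the
    central cell, whose size is then forced: 2(mn + 1) - 2m|lam| vertices in every face of type lam.
    This constancy is what turns the double count into a division. A diameter is kept in both
    orientations; the central cell then degenerates to its two ends, which settles |lam| = n without
    a separate argument.

    With s = sum_w w c_w and L = sum_w c_w, the division multiplies F(N, c) by N / (N - s). The
    awkward factor N - s disappears and (N + L - 1)! / ((N - 1)! prod_w c_w!) remains. The value of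
    mu has the same shape because mn + 1 = eN: the numerator starts at a multiple of e. If e fails
    to divide some multiplicity, there is no fixed face and a vanishing factor survives in mu. *)

(** * Points and their smallest enclosing sets *)

Section MinCover.
Variables (A T : finType) (ins : A -> T -> bool) (le : rel A).

(** The incidence relation is abstract because the construction serves twice: for intervals of
    [0, N] and for arcs of the polygon. *)
Definition mincell (P : {set A}) (I : A) : {set T} :=
  [set z | ins I z & [forall J in P, ins J z ==> le I J]].

Lemma mincellP (P : {set A}) I z :
  reflect (ins I z /\ forall J, J \in P -> ins J z -> le I J)
          (z \in mincell P I).
Proof.
rewrite inE; apply: (iffP andP) => -[Iz HI]; split=> //.
  by move=> J JP Jz; move/forall_inP: HI => /(_ J JP) /implyP /(_ Jz).
by apply/forall_inP => J JP; apply/implyP; apply: HI.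
Qed.

(** The members that contain a given point form a chain, which [len] makes strict; so every covered
    point has exactly one smallest enclosing member. *)
Lemma sum_mincell (P : {set A}) (len : A -> nat) :
    (forall I J z, I \in P -> J \in P -> ins I z -> ins J z ->
       le I J || le J I) ->
    (forall I J, I \in P -> J \in P -> le I J -> I = J \/ len I < len J) ->
  \sum_(I in P) #|mincell P I| = #|[set z | [exists I in P, ins I z]]|.
Proof.
move=> tot mono.
pose f z := [pick I in P | z \in mincell P I].
rewrite -[RHS]sum1_card.
have fP z I : I \in P -> (z \in mincell P I) = (f z == Some I).
  move=> IP; rewrite /f; case: pickP => [J /andP[JP zJ]|no]; last first.
    by move: (no I); rewrite IP /= => ->.
  apply/idP/eqP => [zI|[<-]] //; congr Some.
  move/mincellP: zJ => [Jz zJ]; move/mincellP: zI => [Iz zI].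
  have := mono _ _ IP JP (zI _ JP Jz); have := mono _ _ JP IP (zJ _ IP Iz).
  by move=> [->|h1] // [->|h2] //; lia.
rewrite (partition_big f (fun o : option A => if o is Some J then J \in P else false)) /=.
  rewrite (eq_bigr (fun I => \sum_(z in mincell P I) 1)); last first.
    by move=> I _; rewrite sum1_card.
  rewrite [RHS](reindex_omap Some id) /=; last by case.
  apply: eq_big => [I|I]; first by rewrite eqxx andbT.
  move=> IP; apply: eq_bigl => z; rewrite inE (fP _ _ IP).
  case: eqP => [e|]; last by rewrite andbF.
  rewrite andbT; symmetry; apply/exists_inP; exists I => //.
  by have : z \in mincell P I by [rewrite fP // e]; case/mincellP.
move=> z; rewrite inE => /exists_inP[I0 I0P I0z].
rewrite /f; case: pickP => [J /andP[]|no] //.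
have pI0 : (I0 \in P) && ins I0 z by rewrite I0P.
case: (@arg_minnP _ I0 (fun I => (I \in P) && ins I z) len pI0) => I /andP[IP Iz] min.
have := no I; rewrite IP /= => /negbT/negP; case.
apply/mincellP; split=> // J JP Jz.
have := tot I J z IP JP Iz Jz; case/orP => // leJI.
case: (mono J I JP IP leJI) => [e|]; first by rewrite e in leJI *.
by have := min J; rewrite JP Jz => /(_ isT); lia.
Qed.

End MinCover.

(** * Noncrossing families of intervals *)

Section LinearFamilies.
Variable K : nat.
Local Notation T := 'I_K.
Implicit Types (I J : T * T) (P Q : {set T * T}) (x z : T) (c : nat -> nat).

Definition inside I z := (I.1 < z < I.2)%N.
Definition subint I J := (J.1 <= I.1)%N && (I.2 <= J.2)%N.

(** The ends live in a fixed ['I_K] while [N] varies in the induction. [K] will be the number of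
    vertices, so that arcs become intervals without conversion. *)
Definition linfam N P :=
  [forall I in P, [&& I.1.+1 < I.2, I.2 <= N &
    [forall J in P, ~~ [&& I.1 < J.1, J.1 < I.2 & I.2 < J.2]]]].

Definition weight P I := #|mincell inside subint P I|.

(** The linear counterpart of the central cell. For a family in [0, N] it always contains both 0 and
    N. *)
Definition outer N P := [set z : T | z <= N & [forall J in P, ~~ inside J z]].

Lemma linfamP N P :
  reflect (forall I, I \in P -> [/\ I.1.+1 < I.2, I.2 <= N &
     forall J, J \in P -> ~ [/\ I.1 < J.1, J.1 < I.2 & I.2 < J.2]])
    (linfam N P).
Proof.
apply: (iffP forall_inP) => h I IP.
  have /and3P[h1 h2 /forall_inP h3] := h I IP; split=> // J JP [*].
  by move/negP: (h3 J JP); apply; apply/and3P.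
have [h1 h2 h3] := h I IP; rewrite h1 h2 /=; apply/forall_inP => J JP.
by apply/and3P; apply: h3.
Qed.

Lemma outerP N P z :
  reflect (z <= N /\ forall J, J \in P -> ~~ inside J z) (z \in outer N P).
Proof.
by rewrite inE; apply: (iffP andP) => -[? /forall_inP].
Qed.

Lemma sum_weight N P : N < K -> linfam N P ->
  #|outer N P| + \sum_(I in P) weight P I = N.+1.
Proof.
move=> NK /linfamP PP.
rewrite /weight (@sum_mincell _ _ _ _ P (fun I => I.2 - I.1)); first last.
- move=> [a b] [u v] IP JP; rewrite /subint /=; move=> h.
  have [/= h1 _ _] := PP _ IP; have [/= h2 _ _] := PP _ JP.
  have [e|] := eqVneq (a : nat) u; have [e'|] := eqVneq (b : nat) v.
  - by left; congr pair; apply/val_inj.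
  - by right; lia.
  - by right; lia.
  - by right; lia.
- move=> [a b] [u v] z IP JP; rewrite /subint /inside /= => h1 h2.
  have [/= _ _ /(_ _ JP)/= h3] := PP _ IP.
  have [/= _ _ /(_ _ IP)/= h4] := PP _ JP.
  apply/negPn/negP => h5; case: (ltnP a u) => h6.
    by apply: h3; split; lia.
  by apply: h4; split; lia.
rewrite -cardsUI (_ : _ :&: _ = set0) ?cards0 ?addn0; last first.
  apply/setP => z; rewrite !inE; apply/negP.
  case/andP => /andP[_ /forall_inP h] /exists_inP[J JP Jz].
  by move: (h J JP); rewrite Jz.
rewrite (_ : _ :|: _ = [set widen_ord NK i | i : 'I_N.+1]).
  by rewrite card_imset ?card_ord // => i j /(congr1 val) /= /val_inj.
apply/setP => z; rewrite !inE; apply/idP/imsetP => [h|[i _ ->]].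
  have zN : z < N.+1.
    case/orP: h => [/andP[]//|/exists_inP[J JP]].
    by have [_ h _] := PP J JP; rewrite /inside; lia.
  by exists (Ordinal zN) => //; apply/val_inj.
have -> /= : i <= N by rewrite -ltnS.
case: (boolP [exists I in P, inside I (widen_ord NK i)]); rewrite ?orbT //.
by rewrite negb_exists_in => ->.
Qed.

Lemma weight_lt P I : 0 < K -> weight P I < K.
Proof.
move=> K0; rewrite -[K in _ < K]card_ord -cardsT; apply: proper_card.
rewrite properT; apply/negP => /eqP/setP/(_ I.1); rewrite !inE.
by rewrite /inside ltnn.
Qed.

Definition mult P w := #|[set I in P | weight P I == w]|.

Lemma sum_weight_mult P : 0 < K ->
  \sum_(I in P) weight P I = \sum_(w < K) w * mult P w.
Proof.
move=> K0; rewrite (partition_big (fun I => Ordinal (weight_lt P I K0)) xpredT) //.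
apply: eq_bigr => w _; rewrite /mult mulnC -sum_nat_const.
apply: eq_big => [I|I]; first by rewrite inE -val_eqE.
by case/andP => _ /eqP <-.
Qed.

(** No old interval straddles the outer point [x], so those that share an inner point with (x, N)
    are contained in it. The new interval is therefore the smallest enclosing one only for points
    that were outer before. *)
Lemma addtop N P (x y : T) : linfam N P -> y = N :> nat -> x.+1 < N ->
    x \in outer N P -> (x, y) \notin P ->
  [/\ linfam N ((x, y) |: P),
      forall I, I \in P -> weight ((x, y) |: P) I = weight P I &
      weight ((x, y) |: P) (x, y) = #|[set z in outer N P | x < z < N]|].
Proof.
move=> /linfamP PP yN xN /outerP[xleN xo] xyP; split.
- apply/linfamP => I; rewrite 2!inE => /predU1P[->|IP] /=; split=> //; try lia.
  + move=> J; rewrite 2!inE => /predU1P[->|JP] /= [h1 h2 h3]; first lia.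
    by have [] := PP J JP; lia.
  + by have [] := PP I IP.
  + by have [] := PP I IP.
  + move=> J; rewrite 2!inE => /predU1P[->|JP] /= h.
      by have := xo I IP; rewrite /inside; case: h; lia.
    by have [_ _ /(_ J JP)] := PP I IP.
- move=> I IP; apply: eq_card => z.
  apply/mincellP/mincellP => -[Iz h]; split=> // J.
    by move=> JP; apply: h; rewrite 2!inE JP orbT.
  rewrite 2!inE => /predU1P[->|]; last exact: h.
  move: (xo I IP) Iz; have [_ hI _] := PP I IP.
  by rewrite /inside /subint /=; lia.
apply: eq_card => z; rewrite !inE; apply/idP/idP.
  case/andP; rewrite {1}/inside /= => xz /forall_inP h.
  rewrite -yN xz andbT (ltnW (proj2 (andP xz))) /=.
  apply/forall_inP => J JP; apply/negP => Jz.
  have := h J; rewrite 2!inE JP orbT Jz => /(_ isT).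
  rewrite /subint /= => hs; have [_ hJ _] := PP J JP.
  have := xo J JP; move: Jz xz; rewrite /inside => Jz xz; move=> hx.
  case: J JP Jz hs hJ hx => u v /= JP Jz hs hJ hx.
  have e1 : u = x by apply/val_inj => /=; lia.
  have e2 : v = y by apply/val_inj => /=; lia.
  by rewrite e1 e2 (negbTE xyP) in JP.
case/andP => /andP[_ /forall_inP h] xz.
have -> /= : inside (x, y) z by rewrite /inside /= yN.
apply/forall_inP => J; rewrite 2!inE => /predU1P[->|JP].
  by rewrite /subint !leqnn implybT.
by rewrite (negbTE (h J JP)).
Qed.

Lemma linfam_sub N P Q : Q \subset P -> linfam N P -> linfam N Q.
Proof.
move=> /subsetP QP /linfamP PP; apply/linfamP => I /QP IP.
by have [h1 h2 h3] := PP I IP; split=> // J /QP; apply: h3.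
Qed.

(** Together with [card_gt_inj], this recovers the left end of a removed interval from its weight,
    [U] being the set of outer points. *)
Lemma exists_card_gt (U : {set T}) w : w < #|U| ->
  exists2 x, x \in U & #|[set z in U | x < z]| = w.
Proof.
elim: w U => [|w IH] U hU.
  have [x0 x0U] : exists x, x \in U by apply/card_gt0P.
  case: (@arg_maxnP _ x0 (fun x => x \in U) (fun x => x : nat) x0U) => x xU max.
  exists x => //; apply/eqP; rewrite cards_eq0; apply/eqP/setP => z.
  by rewrite !inE; apply/negP => /andP[/max]; lia.
have [x0 x0U] : exists x, x \in U by apply/card_gt0P; exact: ltn_trans (ltn0Sn w) hU.
case: (@arg_maxnP _ x0 (fun x => x \in U) (fun x => x : nat) x0U) => y yU max.
have [|x] := IH (U :\ y); first by move: hU; rewrite (cardsD1 y U) yU.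
rewrite !inE => /andP[xy xU] hx; exists x => //.
have xy' : x < y.
  by have := max x xU => /= h; rewrite ltn_neqAle h andbT;
    apply: contra xy => /eqP/val_inj ->.
rewrite (cardsD1 y) inE yU xy' add1n -hx; congr _.+1.
by apply: eq_card => z; rewrite !inE andbA.
Qed.

Lemma card_gt_inj (U : {set T}) (x y : T) : x \in U -> y \in U ->
  #|[set z in U | x < z]| = #|[set z in U | y < z]| -> x = y.
Proof.
wlog xy : x y / x <= y => [h|] xU yU e.
  by case: (leqP x y) => [/h|/ltnW/h h']; [apply | symmetry; apply: h'].
apply/eqP; apply: contraT => nxy.
suff : #|[set z in U | y < z]| < #|[set z in U | x < z]| by rewrite e ltnn.
apply: proper_card; apply/properP; split.
  by apply/subsetP => z; rewrite !inE; lia.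
by exists y; rewrite !inE yU ?ltnn //= ltn_neqAle xy andbT.
Qed.

(** * Counting families with prescribed weights *)

Definition linfams N c : {set {set T * T}} :=
  [set P | linfam N P & [forall w : 'I_K, mult P w == c w]].

Lemma linfamsP N c P : reflect (linfam N P /\ forall w, w < K -> mult P w = c w)
  (P \in linfams N c).
Proof.
rewrite inE; apply: (iffP andP) => -[hP h]; split=> //.
  by move=> w wK; move/forallP: h => /(_ (Ordinal wK)) /eqP.
by apply/forallP => w; apply/eqP/h.
Qed.

Definition istop N P I := (I.2 == N :> nat) && [forall J in P,
  (J.2 == N :> nat) ==> (I.1 <= J.1)].

Lemma istop_uniq N P I J : I \in P -> J \in P -> istop N P I -> istop N P J -> I = J.
Proof.
case: I J => a b [u v] IP JP /andP[/= /eqP bN /forall_inP h1] /andP[/= /eqP vN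
  /forall_inP h2].
have := h1 _ JP; have := h2 _ IP; rewrite /= vN bN eqxx /= => l1 l2.
by congr pair; apply/val_inj => /=; lia.
Qed.

Definition decr c w := fun v => c v - (v == w).

Lemma sum_decr (h : nat -> nat) c w : w < K -> 0 < c w ->
  \sum_(v < K) h v * c v = \sum_(v < K) h v * decr c w v + h w.
Proof.
move=> wK cw; rewrite (bigD1 (Ordinal wK)) //= [in RHS](bigD1 (Ordinal wK)) //=.
rewrite {1}/decr eqxx addnAC; congr (_ + _).
  by case: (c w) cw => // k _; rewrite mulnS subSS subn0 addnC.
apply: eq_bigr => v nv; rewrite /decr (_ : (v == w :> nat) = false) ?subn0 //.
exact/negbTE.
Qed.

Lemma prod_fact_decr c w : w < K -> 0 < c w ->
  \prod_(v < K) (c v)`! = c w * \prod_(v < K) (decr c w v)`!.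
Proof.
move=> wK cw; rewrite (bigD1 (Ordinal wK)) //= [in RHS](bigD1 (Ordinal wK)) //=.
rewrite {1}/decr eqxx mulnA; congr (_ * _).
  by case: (c w) cw => // k _; rewrite factS subSS subn0.
apply: eq_bigr => v nv; rewrite /decr (_ : (v == w :> nat) = false) ?subn0 //.
exact/negbTE.
Qed.

Lemma mult_addtop N P (x y : T) w : linfam N P -> y = N :> nat -> x.+1 < N ->
    x \in outer N P -> (x, y) \notin P ->
  mult ((x, y) |: P) w = mult P w + (weight ((x, y) |: P) (x, y) == w).
Proof.
move=> h1 h2 h3 h4 h5; have [_ hw _] := addtop h1 h2 h3 h4 h5.
rewrite /mult (cardsD1 (x, y)) addnC !inE eqxx /=; congr (_ + _).
apply: eq_card => I; rewrite !inE; case: eqVneq => [->|_] /=.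
  by rewrite (negbTE h5).
by case IP: (I \in P) => //=; rewrite hw.
Qed.

(** An interval strictly around the left end of [I] would either end at [N] and start further left,
    or end earlier and cross [I]. *)
Lemma outer_top N P (I : T * T) : linfam N P -> I \in P -> istop N P I ->
  I.1 \in outer N (P :\ I).
Proof.
move=> /linfamP PP IP /andP[/eqP IN /forall_inP top].
have [h1 h2 _] := PP _ IP.
apply/outerP; split; first lia.
move=> J; rewrite 2!inE => /andP[_ JP]; apply/negP; rewrite /inside => h.
have [_ h4 /(_ _ IP) h3] := PP _ JP; have := top _ JP => h5.
have [e|ne] := eqVneq (J.2 : nat) N; first by move: h5; rewrite e eqxx /=; lia.
by apply: h3; split; lia.
Qed.

(** Removing the top interval is a bijection: its weight [w] is the number of outer points between
    its left end and N + 1, so it can be put back in exactly one way. *)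
Lemma card_linfams_top N c w : N.+1 < K -> c 0 = 0 ->
    \sum_(w < K) w * c w <= N -> w < K ->
  #|[set P in linfams N.+1 c |
      [exists I in P, istop N.+1 P I && (weight P I == w)]]| =
  if 0 < c w then #|linfams N.+1 (decr c w)| else 0.
Proof.
move=> NK c0 cN wK.
set Tp := [set P in _ | _]; pose yN : T := Ordinal NK.
case: ifP => cw; last first.
  apply/eqP; rewrite cards_eq0; apply/eqP/setP => P; rewrite in_set0 inE.
  apply/negP => /andP[/linfamsP[_ h] /exists_inP[I IP /andP[_ wI]]].
  have := h w wK; have -> : c w = 0 by lia.
  move/eqP; rewrite cards_eq0 => /eqP/setP/(_ I).
  by rewrite !inE IP wI.
pose f P := [set I in P | ~~ istop N.+1 P I].
have fE P I : I \in P -> istop N.+1 P I -> f P = P :\ I.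
  move=> IP It; apply/setP => J; rewrite !inE andbC.
  case JP: (J \in P); rewrite ?andbF // !andbT; congr negb; apply/idP/eqP => [Jt|->//].
  exact: istop_uniq JP IP Jt It.
have TpE P : P \in Tp -> exists x, [/\ (x, yN) \in P, istop N.+1 P (x, yN),
   weight P (x, yN) = w, x.+1 < N.+1 & linfam N.+1 P /\ forall v, v < K ->
     mult P v = c v].
  rewrite inE => /andP[/linfamsP[hP h] /exists_inP[[x y] IP /andP[It /eqP wI]]].
  have yE : y = yN by apply/val_inj => /=; case/andP: It => /eqP.
  rewrite yE in IP It wI.
  exists x; split=> //; by case/linfamP/(_ _ IP): hP.
have Tpout P x : (x, yN) \in P -> istop N.+1 P (x, yN) ->
    linfam N.+1 P -> x.+1 < N.+1 ->
    [/\ linfam N.+1 (f P), (x, yN) |: f P = P, x \in outer N (f P), (x, yN) \notin f P &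
       weight P (x, yN) = #|[set z in outer N (f P) | x < z]|].
  move=> IP It hP xN; rewrite (fE _ _ IP It).
  have h1 : linfam N.+1 (P :\ (x, yN)) by apply: linfam_sub hP; apply: subsetDl.
  have h2 := outer_top hP IP It.
  have h3 : (x, yN) \notin P :\ (x, yN) by rewrite !inE eqxx.
  split=> //; first by rewrite setD1K.
    by case/outerP: h2 => _ h2; apply/outerP; split=> //; lia.
  have [//|//|_ _] := addtop h1 _ _ h2 h3; rewrite setD1K // => ->.
  apply: eq_card => z; rewrite !inE.
  by case: [forall _ in _, _]; rewrite ?andbF //= !andbT; lia.
have <- : f @: Tp = linfams N.+1 (decr c w).
  apply/setP => Q; apply/imsetP/idP => [[P /TpE[x [IP It wI xN [hP hm]]] ->]|].
    have [h1 h2 h3 h4 h5] := Tpout P x IP It hP xN.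
    apply/linfamsP; split=> // v vK.
    have h3' : x \in outer N.+1 (f P).
      by case/outerP: h3 => h3 h3'; apply/outerP; split=> //; lia.
    have := mult_addtop v h1 (erefl : nat_of_ord yN = N.+1) xN h3' h4.
    by rewrite h2 wI hm // /decr eq_sym => ->; rewrite addnK.
  case/linfamsP => hQ hm.
  have w0 : 0 < w by case: (w) cw => //; rewrite c0.
  (* With s the sum of all v c_v, the family [Q] has N + 2 - (s - w) outer points. Leaving out N + 1
     itself, N + 1 - s + w remain, which exceeds [w] since s <= N. *)
  have : w < #|outer N Q|.
    have := sum_weight NK hQ; rewrite sum_weight_mult; last by lia.
    rewrite (eq_bigr (fun v : 'I_K => v * decr c w v)); last by move=> v _; rewrite hm.
    have -> : #|outer N.+1 Q| = #|outer N Q|.+1.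
      rewrite (cardsD1 yN) (_ : yN \in _) ?add1n; last first.
        apply/outerP; split=> // J JP; move/linfamP: hQ => /(_ J JP)[_ h _].
        by rewrite /inside /=; lia.
      congr _.+1; apply: eq_card => z; rewrite !inE.
      have -> : (z != yN) = (z != N.+1 :> nat) by rewrite -val_eqE.
      by case: [forall _ in _, _]; rewrite ?andbF //= !andbT; lia.
    move: cN; rewrite (sum_decr (fun v => v) wK cw) /=.
    by move: (\sum_(v < K) v * decr c w v) #|outer N Q| => A B; lia.
  case/exists_card_gt => x xo xw.
  have [xN xo'] := outerP _ _ _ xo.
  have xo1 : x \in outer N.+1 Q by apply/outerP; split=> //; lia.
  (* Were this interval in [Q], it would cover all points right of [x] up to N, and [w] would be
     0. *)
  have nxy : (x, yN) \notin Q.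
    apply/negP => IQ; have : [set z in outer N Q | x < z] = set0.
      apply/setP => z; rewrite in_set0 inE; apply/negP => /andP[/outerP[zN /(_ _ IQ)]].
      by rewrite /inside /=; lia.
    by move/(congr1 (fun s : {set _} => #|s|)); rewrite xw cards0; lia.
  have xlt : x.+1 < N.+1.
    rewrite ltnS ltn_neqAle xN andbT; apply/eqP => e.
    have : [set z in outer N Q | x < z] = set0.
      by apply/setP => z; rewrite in_set0 inE; apply/negP => /andP[/outerP[zN _]]; lia.
    by move/(congr1 (fun s : {set _} => #|s|)); rewrite xw cards0; lia.
  have [h1 h2 h3] := addtop hQ (erefl : nat_of_ord yN = N.+1) xlt xo1 nxy.
  set P := (x, yN) |: Q in h1 h2 h3.
  have IP : (x, yN) \in P by rewrite !inE eqxx.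
  have It : istop N.+1 P (x, yN).
    rewrite /istop /= eqxx /=; apply/forall_inP => J; rewrite 2!inE => /predU1P[->|JQ].
      by rewrite leqnn implybT.
    apply/implyP => /eqP e; have := xo' J JQ; rewrite /inside /=; lia.
  have Pw : weight P (x, yN) = w.
    rewrite h3 -xw; apply: eq_card => z; rewrite !inE.
    by case: [forall _ in _, _]; rewrite ?andbF //= !andbT; lia.
  exists P; last first.
    rewrite (fE _ _ IP It); apply/setP => J; rewrite !inE.
    by case: eqVneq => [->|//]; rewrite (negbTE nxy).
  rewrite inE; apply/andP; split; last by apply/exists_inP; exists (x, yN);
    rewrite // It Pw /=.
  apply/linfamsP; split=> // v vK.
  rewrite (mult_addtop v hQ (erefl : nat_of_ord yN = N.+1) xlt xo1 nxy) Pw hm //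
    /decr eq_sym.
  by case: eqVneq => [<-|]; lia.
rewrite card_in_imset // =>
  P1 P2 /TpE[x1 [IP1 It1 wI1 xN1 [hP1 _]]] /TpE[x2 [IP2 It2 wI2 xN2 [hP2 _]]] e.
have [_ p1 o1 _ e1] := Tpout P1 x1 IP1 It1 hP1 xN1.
have [_ p2 o2 _ e2] := Tpout P2 x2 IP2 It2 hP2 xN2.
rewrite -p1 -p2 -e; rewrite -e in o2 e2; congr ((_, _) |: _).
by apply: (card_gt_inj o1 o2); rewrite -e1 -e2 wI1 wI2.
Qed.

Lemma card_linfams_rec N c : N.+1 < K -> c 0 = 0 ->
    \sum_(w < K) w * c w <= N ->
  #|linfams N.+1 c| =
    #|linfams N c| + \sum_(w < K | 0 < c w) #|linfams N.+1 (decr c w)|.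
Proof.
move=> NK c0 cN; have K0 : 0 < K by lia.
rewrite -(cardsID [set P : {set T * T} | [exists I in P, istop N.+1 P I]]) addnC;
  congr (_ + _).
  apply: eq_card => P; rewrite !inE andbC.
  case: (boolP [forall w, _]) => hm; rewrite ?andbF // !andbT.
  apply/andP/idP => [[/linfamP hP nt]|/linfamP hP]; last first.
    split; first by apply/linfamP => I /hP[h1 h2 h3]; split=> //; lia.
    apply/exists_inP => -[I /hP[h1 h2 _]] /andP[/eqP]; lia.
  apply/linfamP => I IP; have [h1 h2 h3] := hP I IP; split=> //.
  rewrite -ltnS ltn_neqAle h2 andbT; apply/negP => IN; case/negP: nt.
  have pI : (I \in P) && (I.2 == N.+1 :> nat) by rewrite IP.
  case: (@arg_minnP _ I (fun J => (J \in P) && (J.2 == N.+1 :> nat)) (fun J =>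
    J.1 : nat) pI) => J /andP[JP JN] min.
  apply/exists_inP; exists J => //; rewrite /istop JN /=.
  by apply/forall_inP => J' J'P; apply/implyP => J'N; apply: min; rewrite J'P.
rewrite [RHS]big_mkcond /=.
(* The default weight 0 is never reached: only families with a top interval are summed over. *)
pose g P : 'I_K := if [pick I in P | istop N.+1 P I] is Some J
  then Ordinal (weight_lt P J K0) else Ordinal K0.
rewrite -sum1_card (partition_big g xpredT) //; apply: eq_bigr => w _.
rewrite -(card_linfams_top NK c0 cN (ltn_ord w)) -[RHS]sum1_card.
apply: eq_bigl => P; rewrite !inE -andbA; congr (_ && _).
apply/andP/exists_inP => [[/exists_inP[I IP It] /eqP gP]|[I IP /andP[It /eqP wI]]].
  exists I => //; rewrite It /= -gP /g.
  case: pickP => [J /andP[JP Jt]|/(_ I)]; last by rewrite IP It.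
  by rewrite (istop_uniq IP JP It Jt) /=.
split; first by apply/exists_inP; exists I.
apply/eqP/val_inj; rewrite /g; case: pickP => [J /andP[JP Jt]|/(_ I)];
  last by rewrite IP It.
by rewrite (istop_uniq JP IP Jt It) /= wI.
Qed.

Lemma linfams_weight N c P : N < K -> P \in linfams N c ->
  #|outer N P| + \sum_(w < K) w * c w = N.+1.
Proof.
move=> NK /linfamsP[hP hm]; rewrite -(sum_weight NK hP) sum_weight_mult; last by lia.
by congr (_ + _); apply: eq_bigr => w _; rewrite hm.
Qed.

(** Both terms of the recursion lower N + sum_w c_w. The bound admits equality, where both sides
    vanish, because the recursion passes from N + 1 to N with the same [c]. *)
Theorem card_linfams N c : 0 < N -> N < K -> c 0 = 0 ->
    \sum_(w < K) w * c w <= N ->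
  #|linfams N c| * (N`! * \prod_(w < K) (c w)`!) =
    (N - \sum_(w < K) w * c w) * (N + \sum_(w < K) c w).-1`!.
Proof.
move: {2}(N + _).+1 (ltnSn (N + \sum_(w < K) c w)) => k.
elim: k N c => // k IH [//|N] c hk _ NK c0.
rewrite leq_eqVlt => /predU1P[e|cN].
  (* A family would have a single outer point, yet 0 and N + 1 are both outer. *)
  rewrite e subnn mul0n; apply/eqP; rewrite muln_eq0; apply/orP; left.
  rewrite cards_eq0; apply/eqP/setP => P; rewrite in_set0; apply/negP => hP.
  have := linfams_weight NK hP; rewrite e => h.
  pose y1 : T := Ordinal NK; pose y0 : T := Ordinal (leq_ltn_trans (leq0n _) NK).
  have : [set y0; y1] \subset outer N.+1 P.
    case/linfamsP: hP => /linfamP hP _.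
    apply/subsetP => z /set2P zE; apply/outerP; split; first by case: zE => -> /=.
    by move=> J /hP[]; case: zE => ->; rewrite /inside /=; lia.
  move/subset_leq_card; rewrite cards2 (_ : y0 != y1) //; move: h.
  by move: #|_| => A; lia.
rewrite ltnS in cN.
rewrite (card_linfams_rec NK c0 cN) mulnDl.
set s := \sum_(w < K) w * c w in cN *; set L := \sum_(w < K) c w in hk *.
have -> : (\sum_(w < K | 0 < c w) #|linfams N.+1 (decr c w)|) *
    (N.+1`! * \prod_(w < K) (c w)`!) =
    \sum_(w < K) (c w * (N.+1 - s + w) * (N + L).-1`!).
  rewrite big_distrl /= big_mkcond /=; apply: eq_bigr => w _.
  case: posnP => [->|cw]; first by rewrite !mul0n.
  have sE := sum_decr (fun v => v) (ltn_ord w) cw.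
  have LE : L = \sum_(v < K) decr c w v + 1.
    have := sum_decr (fun v => 1) (ltn_ord w) cw.
    by under eq_bigr do rewrite mul1n; under [X in _ = X + _]eq_bigr do rewrite mul1n.
  rewrite -/s in sE.
  rewrite (prod_fact_decr (ltn_ord w) cw) (mulnCA (N.+1)`! (c w)) (mulnCA _ (c w))
    -[RHS]mulnA; congr (_ * _).
  rewrite IH //; [|lia|by rewrite /decr c0|lia].
  congr (_ * _`!); lia.
rewrite -big_distrl /=.
have -> : \sum_(w < K) c w * (N.+1 - s + w) = (N.+1 - s) * L + s.
  rewrite (eq_bigr (fun w : 'I_K => (N.+1 - s) * c w + w * c w)); last by move=> w _; lia.
  by rewrite big_split /= -big_distrr.
(* At length 0 the formula would give 0 although the empty family exists, so N = 0 is computed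
   directly: s = 0 and all c_w vanish. *)
case: (posnP N) => [N0|N0].
  have c00 w : w < K -> c w = 0.
    move=> wK; have : w * c w <= s by rewrite /s (bigD1 (Ordinal wK)) //= leq_addr.
    rewrite (_ : s = 0) ?leqn0 ?muln_eq0; last by lia.
    by case/orP => /eqP // ->.
  have -> : L = 0 by rewrite /L big1 // => w _; rewrite c00.
  have -> : s = 0 by lia.
  rewrite N0 /= (_ : \prod_(w < K) (c w)`! = 1); last by rewrite big1 // => w _;
    rewrite c00.
  rewrite (_ : #|linfams 0 c| = 1) //.
  rewrite (_ : linfams 0 c = [set set0]) ?cards1 //; apply/setP => P; rewrite in_set1.
  apply/linfamsP/eqP => [[/linfamP hP _]|->].
    by apply/setP => I; rewrite in_set0; apply/negP => /hP[]; lia.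
  split; first by apply/linfamP => I; rewrite in_set0.
  by move=> w wK; rewrite c00 // /mult (_ : [set I in _ | _] = set0) ?cards0 //;
    apply/setP => I; rewrite !inE.
have := IH N c _ N0 (ltnW NK) c0 cN; rewrite -/s -/L => /(_ _); rewrite factS => IHN.
rewrite -mulnA mulnCA IHN; last by lia.
have -> : (N + L)`! = (N + L) * (N + L).-1`! by rewrite -[X in X`!]prednK ?factS
  ?prednK //; lia.
(* What remains is (N + 1)(N - s) + (N + 1 - s) L + s = (N + 1 - s)(N + L). *)
rewrite !mulnA -mulnDl; congr (_ * _); nia.
Qed.
End LinearFamilies.

(** * Arcs and cells of a dissection *)

Definition halfgon (m n : nat) := (m * n).+1.

Section Distance.
Variables m n : nat.
Local Notation V := (vertex m n).
Local Notation H := (halfgon m n).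
Implicit Types (x y z u v a b p q o : V) (I J : V * V) (S d e : {set V}) (E : {set
  {set V}}).

Definition dist x y : nat := (y - x)%R.

Lemma cardV : (2 * m * n).+2 = 2 * H.
Proof. by rewrite /halfgon; lia. Qed.

Lemma distP x y : [/\ x < 2 * H, y < 2 * H, dist x y < 2 * H &
  (x <= y /\ dist x y + x = y) \/ (y < x /\ dist x y + x = y + 2 * H)].
Proof.
rewrite -cardV; split; try exact: ltn_ord.
rewrite /dist /= modnDmr.
have := ltn_ord x; have := ltn_ord y.
move: (nat_of_ord x) (nat_of_ord y) => {}x {}y; move: (2 * m * n).+2 => M yM xM.
case: (leqP x y) => xy; [left|right]; split=> //.
  have -> : y + (M - x) = (y - x) + M by lia.
  by rewrite modnDr modn_small; lia.
by rewrite modn_small; lia.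
Qed.

Lemma dist_lt x y : dist x y < 2 * H. Proof. by case: (distP x y). Qed.

Lemma dist0 x y : (dist x y == 0) = (x == y).
Proof.
by apply/eqP/eqP => [h|->]; [apply/val_inj => /=|];
  [case: (distP x y)|case: (distP y y)] => *; lia.
Qed.

Lemma distxx x : dist x x = 0. Proof. by apply/eqP; rewrite dist0. Qed.

(** Seen from a base point [o], a distance is a difference of two positions, up to one full turn.
    This turns cyclic arguments into linear arithmetic. *)
Lemma distB o a b :
  (dist o a <= dist o b /\ dist a b + dist o a = dist o b) \/
  (dist o b < dist o a /\ dist a b + dist o a = dist o b + 2 * H).
Proof. by case: (distP o a) (distP o b) (distP a b) => ? ? ? ? [? ? ? ?] [? ? ? ?];
  lia. Qed.

Lemma dist_inj o a b : dist o a = dist o b -> a = b.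
Proof.
by move=> h; apply/val_inj => /=; case: (distP o a) (distP o b) => ? ? ? ? [? ? ? ?]; lia.
Qed.
End Distance.

(* [cyc o] reads every distance off the positions of its ends clockwise from o. *)
Ltac dgen a b :=
  let h := fresh in have h := dist_lt a b;
  let k := fresh "k" in set (k := dist a b) in *; clearbody k.
Ltac rwxx := repeat match goal with
  | |- context [@dist ?m ?n ?a ?a] => rewrite (distxx a)
  | H : context [@dist ?m ?n ?a ?a] |- _ => rewrite (distxx a) in H end.
Ltac cyc o := cbn [fst snd] in *; rwxx;
  repeat match goal with
  | |- context [@dist ?m ?n ?a ?b] => lazymatch a with o => fail | _ =>
      let h := fresh in have h := distB o a b; dgen a b end
  | H : context [@dist ?m ?n ?a ?b] |- _ => lazymatch a with o => fail | _ =>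
      let h := fresh in have h := distB o a b; dgen a b end
  end; rwxx;
  repeat match goal with
  | |- context [@dist ?m ?n ?a ?b] => dgen a b
  | H : context [@dist ?m ?n ?a ?b] |- _ => dgen a b
  end; try lia.

Section Arcs.
Variables m n : nat.
Local Notation V := (vertex m n).
Local Notation H := (halfgon m n).
Implicit Types (x y z u v a b p q o : V) (I J : V * V) (S d e : {set V}) (E : {set
  {set V}}).

Lemma in_arc x y z : (z \in arc x y) = (0 < dist x z < dist x y).
Proof. by rewrite inE. Qed.

Definition ins I z := 0 < dist I.1 z < dist I.1 I.2.
Definition subarc I J := dist J.1 I.1 + dist I.1 I.2 <= dist J.1 J.2.
(* A diameter contributes both of its orientations. *)
Definition shorts E : {set V * V} :=
  [set I | [set I.1; I.2] \in E & dist I.1 I.2 <= H].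
Definition arcwt E I := #|mincell ins subarc (shorts E) I|.
Definition ucell E I : {set V} := I.1 |: (I.2 |: mincell ins subarc (shorts E) I).
(** The vertices of the central cell. In a dissection that contains a diameter these are its two
    ends, and there is no central cell. *)
Definition freepts E : {set V} := [set z | ~~ [exists I in shorts E, ins I z]].

Lemma freeptsP E z : reflect (forall I, I \in shorts E -> ~~ ins I z) (z \in freepts E).
Proof. by rewrite inE negb_exists_in; apply: forall_inP. Qed.

Lemma dist_succ x : dist x (x + 1)%R = 1.
Proof. by rewrite /dist addrC addKr /= modn_small. Qed.

Lemma set2_side x y : ([set x; y] \in sides m n) = (dist x y == 1) || (dist y x == 1).
Proof.
have succE (t s : V) : dist t s = 1 -> s = (t + 1)%R.
  by move=> h; apply: (@dist_inj _ _ t); rewrite dist_succ.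
apply/imsetP/idP => [[t _ e]|].
  have h1 : x \in [set t; (t + 1)%R] by rewrite -e !inE eqxx.
  have h2 : y \in [set t; (t + 1)%R] by rewrite -e !inE eqxx orbT.
  have h3 : t \in [set x; y] by rewrite e !inE eqxx.
  have h4 : (t + 1)%R \in [set x; y] by rewrite e !inE eqxx orbT.
  have nt : t <> (t + 1)%R by move=> h; have := dist_succ t; rewrite -h distxx.
  case/set2P: h1 h2 h3 h4 => -> /set2P[] ->; rewrite ?dist_succ ?eqxx ?orbT // !inE ?orbb.
    by move=> _ /eqP h; case: nt.
  by move=> /eqP h; case: nt.
by case/orP => /eqP/succE ->; [exists x | exists y] => //; rewrite setUC.
Qed.

Lemma cellsP E S : reflect (2 < #|S| /\ forall x y, x \in S -> y \in S -> x != y ->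
    consecutive S x y = ([set x; y] \in sides m n :|: E)) (S \in cells E).
Proof.
rewrite inE; apply: (iffP andP) => -[h1 h2]; split=> //.
  move=> x y xS yS nxy; move/forall_inP: h2 => /(_ x xS) /forall_inP /(_ y yS).
  by rewrite nxy => /eqP.
apply/forall_inP => x xS; apply/forall_inP => y yS; apply/implyP => nxy.
by apply/eqP/h2.
Qed.

Lemma arc_disjP x y S : reflect (forall z, z \in S -> ~~ (0 < dist x z < dist x y))
  (arc x y :&: S == set0).
Proof.
apply: (iffP eqP) => [/setP h z zS|h].
  by have := h z; rewrite in_setI in_arc zS andbT in_set0 => ->.
apply/setP => z; rewrite in_setI in_arc in_set0; apply/negP => /andP[h1 zS].
by have := h z zS; rewrite h1.
Qed.

(** * Nesting and weights of the arcs of one dissection *)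

Section OneDissection.
Variable E : {set {set V}}.
Hypotheses (Ediag : E \subset diagonals m n) (Enc : noncrossing E).
Set Default Proof Using "Ediag Enc".

Lemma E_dist x y : [set x; y] \in E -> 1 < dist x y /\ 1 < dist y x.
Proof.
move=> xyE; have := subsetP Ediag _ xyE; rewrite inE cards2 => /andP[].
case: (eqVneq x y) => // nxy _; rewrite set2_side negb_or => /andP[h1 h2].
have h3 : dist x y != 0 by rewrite dist0.
have h4 : dist y x != 0 by rewrite dist0 eq_sym.
by lia.
Qed.

Lemma E_pair d : d \in E -> exists I, I \in shorts E /\ d = [set I.1; I.2].
Proof.
move=> dE; have := subsetP Ediag _ dE; rewrite inE => /andP[/cards2P[x [y [nxy e]]] _].
rewrite e in dE *; case: (leqP (dist x y) H) => h.
  by exists (x, y); rewrite inE /= dE.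
exists (y, x); rewrite inE /= setUC dE; split=> //.
by cyc x.
Qed.

Lemma E_noncross x y u v : [set x; y] \in E -> [set u; v] \in E ->
  ~ (0 < dist x u < dist x y /\ dist x y < dist x v).
Proof.
move=> xyE uvE [h1 h2]; move/forall_inP: Enc => /(_ _ xyE) /forall_inP /(_ _ uvE).
move/negP; apply; apply/exists_inP; exists x; first by rewrite !inE eqxx.
apply/exists_inP; exists y; first by rewrite !inE eqxx orbT.
apply/andP; split; apply/set0Pn; [exists u|exists v];
  rewrite in_setI in_arc !inE eqxx ?orbT andbT //.
by cyc x.
Qed.

Lemma shortsP I : I \in shorts E -> [/\ [set I.1; I.2] \in E, 1 < dist I.1 I.2,
  dist I.1 I.2 <= H & 1 < dist I.2 I.1].
Proof. by rewrite inE => /andP[h1 h2]; have [] := E_dist h1. Qed.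

Lemma shorts_noncross I J : I \in shorts E -> J \in shorts E ->
  ~ (0 < dist I.1 J.1 < dist I.1 I.2 /\ dist I.1 I.2 < dist I.1 J.2) /\
  ~ (0 < dist I.1 J.2 < dist I.1 I.2 /\ dist I.1 I.2 < dist I.1 J.1).
Proof.
move=> /shortsP[h1 _ _ _] /shortsP[h2 _ _ _]; split; first exact: E_noncross.
by apply: E_noncross => //; rewrite setUC.
Qed.

(** Noncrossing arcs with a common inner vertex that are not nested go all the way around together.
    Two arcs of at most half a turn that share an inner vertex are too short for this. *)
Lemma shorts_nested I J z : I \in shorts E -> J \in shorts E ->
  ins I z -> ins J z -> subarc I J || subarc J I.
Proof.
move=> IE JE; have [n1 n2] := shorts_noncross IE JE.
case/shortsP: IE => _ h1 h2 _; case/shortsP: JE => _ h3 h4 _.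
case: I J h1 h2 h3 h4 n1 n2 => x y [u v];
  rewrite /ins /subarc /= => h1 h2 h3 h4 n1 n2 h5 h6.
by cyc x.
Qed.

Lemma subarc_mono I J : I \in shorts E -> J \in shorts E -> subarc I J ->
  I = J \/ dist I.1 I.2 < dist J.1 J.2.
Proof.
case: I J => x y [u v] /shortsP[_ h1 h2 _] /shortsP[_ h3 h4 _];
  rewrite /subarc /= in h1 h2 h3 h4 * => h.
case: (ltnP (dist x y) (dist u v)) => h'; [by right | left].
have e : u = x by apply/eqP; rewrite -dist0; lia.
rewrite e in h h' *; congr pair; apply: (@dist_inj _ _ x); rewrite distxx in h; lia.
Qed.

Lemma sum_arcwt : #|freepts E| + \sum_(I in shorts E) arcwt E I = 2 * H.
Proof.
rewrite /arcwt (@sum_mincell _ _ _ _ _ (fun I => dist I.1 I.2)).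
- rewrite (_ : [set z | _] = ~: freepts E) ?cardsC ?card_ord ?cardV //.
  by apply/setP => z; rewrite !inE negbK.
- exact: shorts_nested.
- exact: subarc_mono.
Qed.

(** The count of covered vertices made inside one arc: the smallest enclosing arc of an inner vertex
    of [I] lies below [I]. It links weights, which are cell sizes minus 2, to lengths. *)
Lemma sum_arcwt_sub I : I \in shorts E ->
  \sum_(J in shorts E | subarc J I) arcwt E J = (dist I.1 I.2).-1.
Proof.
move=> IE; have IP := shortsP IE.
pose Q := [set J in shorts E | subarc J I].
have QE J : J \in Q -> J \in shorts E by rewrite inE => /andP[].
have IQ : I \in Q by rewrite inE IE /subarc distxx /=.
have -> : (dist I.1 I.2).-1 = #|[set z | [exists J in Q, ins J z]]|.
  have -> : [set z | [exists J in Q, ins J z]] = [set z | ins I z].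
    apply/setP => z; rewrite !inE; apply/exists_inP/idP => [[J]|Iz]; last by exists I.
    rewrite inE => /andP[JE]; case: J JE => u v JE;
      case: I IE IP {Q QE IQ} => x y IE [_ h1 h2 h3].
    case/shortsP: JE => _ h4 h5 h6;
      rewrite /subarc /ins /= in h1 h2 h3 h4 h5 h6 * => h7 h8.
    by cyc x.
  have lt2 : dist I.1 I.2 < (2 * m * n).+2 by apply: ltn_ord.
  pose f (k : 'I_(dist I.1 I.2).-1) : V := (I.1 + inord k.+1)%R.
  have distf k : dist I.1 (f k) = k.+1.
    rewrite /dist /f addrC addKr inordK //; have := ltn_ord k; lia.
  rewrite -[LHS]card_ord -(@card_imset _ _ f); last first.
    move=> i j e; apply/val_inj => /=; have := distf i; rewrite e distf; lia.
  apply: eq_card => z; rewrite inE /ins; apply/imsetP/idP => [[k _ ->]|h].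
    by rewrite distf; have := ltn_ord k; lia.
  have zk : (dist I.1 z).-1 < (dist I.1 I.2).-1 by lia.
  by exists (Ordinal zk) => //; apply: (@dist_inj _ _ I.1); rewrite distf /=; lia.
rewrite -(@sum_mincell _ _ ins subarc Q (fun I => dist I.1 I.2)); first last.
- by move=> J K /QE JE /QE KE; apply: subarc_mono.
- by move=> J K z /QE JE /QE KE; apply: shorts_nested.
apply: eq_big => [J|J]; first by rewrite [in RHS]inE.
case/andP => JE JI; apply: eq_card => z; apply/mincellP/mincellP => -[Jz h]; split=> //.
  by move=> K /QE; apply: h.
move=> K KE Kz; case KI: (subarc K I); first by apply: h => //; rewrite inE KE.
have := shorts_nested JE KE Jz Kz => /orP[//|KJ].
move: KI; case: (I) (J) (K) IE JE KE JI KJ {Jz Kz h} => x y [u v] [p q].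
move=> /shortsP[_ k1 k2 k3] /shortsP[_ k4 k5 k6] /shortsP[_ k7 k8 k9];
  rewrite /subarc /= in k1 k2 k3 k4 k5 k6 k7 k8 k9 * => h1 h2 h3.
by cyc x.
Qed.

(* The longest arc of Q that contains the successor of a starts at a and must
   reach b. *)
Lemma gap_chord (Q : {set V * V}) a b : Q \subset shorts E -> a != b ->
    (forall z, 0 < dist a z < dist a b -> exists2 J, J \in Q & ins J z) ->
    (forall J, J \in Q -> ~~ ins J a /\ ~~ ins J b) ->
  dist a b = 1 \/ (a, b) \in Q.
Proof.
move=> /subsetP QE nab cov out.
have dab : 0 < dist a b by rewrite lt0n dist0.
case: (ltnP 1 (dist a b)) => h1; last by left; lia.
right; set a1 := (a + 1)%R; have da1 : dist a a1 = 1 by exact: dist_succ.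
have [J0 J0Q J0a] : exists2 J, J \in Q & ins J a1 by apply: cov; rewrite da1.
have pJ0 : (J0 \in Q) && ins J0 a1 by rewrite J0Q.
case: (@arg_maxnP _ J0 (fun J => (J \in Q) && ins J a1) (fun J => dist J.1 J.2) pJ0)
  => -[u v] /andP[JQ Ja1] max.
have [JE J2 JH J2'] := shortsP (QE _ JQ).
have [Ja Jb] := out _ JQ.
rewrite /ins /= in Ja1 Ja Jb J2 JH J2'.
have e : u = a.
  by apply/eqP; rewrite -dist0; clear -Ja1 Ja Jb J2 JH J2' da1; cyc a.
subst u; rewrite distxx in Ja.
have vb : dist a v <= dist a b by clear -Jb dab; lia.
move: vb; rewrite leq_eqVlt => /orP[/eqP/dist_inj <- //|vb].
have [[u' v'] J'Q J'v] : exists2 J, J \in Q & ins J v by apply: cov; clear -vb J2; lia.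
have [J'E J2a J2b J2c] := shortsP (QE _ J'Q).
have [n1 n2] := shorts_noncross (QE _ JQ) (QE _ J'Q).
have [J'a J'b] := out _ J'Q.
rewrite /ins /= in J'v J'a J'b J2a J2b J2c n1 n2.
have := max (u', v'); rewrite J'Q /ins /= => max'.
have e : u' = a by apply/eqP; rewrite -dist0;
  clear max max' J'E JE cov out QE JQ J'Q pJ0 J0Q J0a; cyc a.
subst u'; have : true && (0 < dist a a1 < dist a v') by clear max max' J'E JE cov out
  QE JQ J'Q pJ0 J0Q J0a; cyc a.
by move/max'; rewrite leqNgt; case: (ltnP (dist a v) (dist a v')) => //; clear -J'v; lia.
Qed.

Lemma ins_ucell I z : I \in shorts E -> z \in ucell E I -> ins I z \/ z = I.1 \/ z = I.2.
Proof.
move=> IE; rewrite !in_setU1 => /orP[/eqP|/orP[/eqP|/mincellP[]]]; tauto.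
Qed.

(** The vertices between two neighbours in the cell are covered by arcs strictly below [I], whereas
    the neighbours themselves are not; so [gap_chord] applies to these arcs. *)
Lemma ucell_gap I a b : I \in shorts E -> a \in ucell E I -> b \in ucell E I ->
    dist I.1 a < dist I.1 b ->
    (forall z, 0 < dist a z < dist a b -> z \notin ucell E I) ->
  dist a b = 1 \/ (a, b) \in shorts E /\ ~~ subarc I (a, b).
Proof.
move=> IE aI bI ab no.
pose Q := [set J in shorts E | ~~ subarc I J & subarc J I].
have IP := shortsP IE.
have nab : a != b by apply: contraTneq ab => ->; rewrite ltnn.
have QE : Q \subset shorts E by apply/subsetP => J; rewrite inE => /andP[].
have aI' := ins_ucell IE aI; have bI' := ins_ucell IE bI.
have bb : dist I.1 b <= dist I.1 I.2.
  by case: bI' => [|[->|->]]; rewrite ?distxx // /ins; clear; lia.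
case: (gap_chord QE nab).
- move=> z zab; have := no z zab.
  have zI : ins I z by rewrite /ins; clear -zab ab bb; cyc I.1.
  rewrite !in_setU1 !negb_or => /and3P[_ _]; rewrite inE zI /= => /forall_inPn[J JE].
  rewrite negb_imply => /andP[Jz nIJ]; exists J => //.
  by rewrite inE JE nIJ /=; have := shorts_nested IE JE zI Jz; rewrite (negbTE nIJ).
- have key c : c \in ucell E I -> forall J, J \in Q -> ~~ ins J c.
    move=> cI J; rewrite inE => /and3P[JE nIJ JI]; apply/negP => Jc.
    have := shortsP JE => -[_ J1 J2 J3]; have IP' := IP.
    move: cI; rewrite !in_setU1 => /or3P[/eqP e|/eqP e|/mincellP[_ /(_ J JE Jc)]].
    + subst c; case: J JE nIJ JI J1 J2 J3 Jc => u v _ _; case: IP';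
      rewrite /ins /subarc /= => _ k1 k2 k3 k4 k5 k6 k7 k8.
      by clear -k1 k2 k3 k4 k5 k6 k7 k8; cyc I.1.
    + subst c; case: J JE nIJ JI J1 J2 J3 Jc => u v _ _; case: IP';
      rewrite /ins /subarc /= => _ k1 k2 k3 k4 k5 k6 k7 k8.
      by clear -k1 k2 k3 k4 k5 k6 k7 k8; cyc I.1.
    + by rewrite (negbTE nIJ).
  by move=> J JQ; split; apply: key.
- by left.
- by rewrite inE => /and3P[? ? _]; right.
Qed.

(** Otherwise the two ends of [I] would be neighbours in the cell below it, hence joined by a side
    or by an arc strictly below [I] with the same ends. *)
Lemma arcwt_gt0 I : I \in shorts E -> 0 < arcwt E I.
Proof.
move=> IE; have [h1 h2 h3 h4] := shortsP IE; rewrite lt0n; apply/negP => h0.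
have hm : mincell ins subarc (shorts E) I = set0 by apply/eqP; rewrite -cards_eq0.
have uE : ucell E I = [set I.1; I.2] by rewrite /ucell hm setU0.
case: (@ucell_gap I I.1 I.2 IE); rewrite ?uE ?inE ?eqxx ?orbT ?distxx //; first lia.
- by move=> z; rewrite !inE => h; apply/negP => /orP[] /eqP e; subst z;
  rewrite ?distxx in h; lia.
- by move=> h; rewrite h in h2.
- by case=> _; rewrite /subarc /= distxx leqnn.
Qed.

Lemma card_ucell I : I \in shorts E -> #|ucell E I| = (arcwt E I).+2.
Proof.
move=> IE; have [h1 h2 h3 h4] := shortsP IE.
rewrite /ucell !cardsU1 !inE /ins distxx /= ltnn andbF /= orbF.
rewrite (_ : (_ == _) = false); first by rewrite !add1n.
by apply/negbTE; rewrite -dist0; lia.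
Qed.

(** * Classification of the cells: one below each arc, and the central one *)

Hypothesis H_gt1 : 1 < H.
Set Default Proof Using "Ediag Enc H_gt1".

Lemma dist_neq x y : x != y -> 0 < dist x y.
Proof. by rewrite -dist0 lt0n. Qed.

(* It suffices to look at one of the two arcs between consecutive points. *)
Lemma cellI S : 2 < #|S| ->
    (forall a b, a \in S -> b \in S -> a != b -> arc a b :&: S == set0 ->
       [set a; b] \in sides m n :|: E) ->
    (forall I, I \in shorts E -> I.1 \in S -> I.2 \in S -> consecutive S I.1 I.2) ->
  S \in cells E.
Proof.
move=> S2 h1 h2; apply/cellsP; split=> // x y xS yS nxy; apply/idP/idP.
  case/orP => h; first exact: h1.
  by rewrite setUC; apply: h1; rewrite // eq_sym.
rewrite in_setU set2_side -orbA => /or3P[/eqP h|/eqP h|xyE].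
- by apply/orP; left; apply/arc_disjP => z _; rewrite h; lia.
- by apply/orP; right; apply/arc_disjP => z _; rewrite h; lia.
- have [I [IE e]] := E_pair xyE.
  have xI : x \in [set I.1; I.2] by rewrite -e !inE eqxx.
  have yI : y \in [set I.1; I.2] by rewrite -e !inE eqxx orbT.
  case/set2P: xI nxy xS yS => -> nxy; case/set2P: yI nxy => ->;
    rewrite ?eqxx // => _ xS yS.
    exact: h2.
  by rewrite /consecutive orbC; apply: h2.
Qed.

Lemma ucell_cell I : I \in shorts E -> ucell E I \in cells E.
Proof.
move=> IE; have [h1 h2 h3 h4] := shortsP IE.
have bnd z : z \in ucell E I -> dist I.1 z <= dist I.1 I.2.
  by move/(ins_ucell IE) => [|[->|->]]; rewrite ?distxx // /ins; clear; lia.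
apply: cellI; first by rewrite card_ucell //; have := arcwt_gt0 IE; lia.
  move=> a b aS bS nab /arc_disjP no; rewrite in_setU set2_side.
  case: (ltnP (dist I.1 a) (dist I.1 b)) => lab.
    case: (ucell_gap IE aS bS lab) => [z zab|->|[]]; rewrite ?eqxx //.
      by apply/negP => /no; rewrite zab.
    by rewrite inE => /andP[-> _] _; rewrite orbT.
  have dab := dist_neq nab.
  have := no I.1; have := no I.2; rewrite !inE !eqxx ?orbT => /(_ isT) n2 /(_ isT) n1.
  have := bnd _ aS; have := bnd _ bS => b1 b2.
  have eb : b = I.1.
    apply/eqP; rewrite eq_sym -dist0; clear no bnd h1 aS bS nab; cyc I.1.
  have ea : a = I.2 by subst b; apply: (@dist_inj _ _ I.1);
    clear no bnd h1 aS bS nab; cyc I.1.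
  by rewrite ea eb setUC h1 orbT.
move=> J JE; have [j1 j2 j3 j4] := shortsP JE => uS vS; have b1 := bnd _ uS;
  have b2 := bnd _ vS.
rewrite /consecutive.
case: (ltnP (dist I.1 J.1) (dist I.1 J.2)) => luv; last first.
  have e1 : J.2 = I.1.
    by apply/eqP; rewrite eq_sym -dist0; clear bnd h1 j1 uS vS; cyc I.1.
  have e2 : J.1 = I.2 by apply: (@dist_inj _ _ I.1); rewrite e1 in j2 j3 j4 luv b2;
    clear bnd h1 j1 uS vS e1; cyc I.1.
  rewrite e1 e2; apply/orP; left; apply/arc_disjP => z /bnd zb.
  by clear bnd h1 j1 uS vS j2 j3 j4 luv b1 b2 e1 e2; cyc I.1.
have JI : subarc J I by rewrite /subarc; clear bnd h1 j1 uS vS; cyc I.1.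
have [eJ|nJ] := eqVneq J I.
  rewrite eJ; apply/orP; right; apply/arc_disjP => z /bnd zb.
  by clear bnd h1 j1 uS vS j2 j3 j4 luv b1 b2 eJ JI; cyc I.1.
apply/orP; left; apply/arc_disjP => z zS; apply/negP => Jz.
have : z \in mincell ins subarc (shorts E) I.
  move: zS; rewrite !in_setU1 => /or3P[/eqP e|/eqP e|//]; subst z; exfalso;
    rewrite /subarc in JI; clear bnd h1 j1 uS vS nJ; cyc I.1.
case/mincellP => _ /(_ J JE Jz) IJ.
have := subarc_mono JE IE JI; have := subarc_mono IE JE IJ.
by move=> [e|l1] [e'|l2]; rewrite ?e ?e' ?eqxx // in nJ; move: l1 l2; clear; lia.
Qed.

Lemma free_cell : 2 < #|freepts E| -> freepts E \in cells E.
Proof.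
move=> f2; apply: cellI => // [a b aS bS nab /arc_disjP no|I IE _ _].
  rewrite in_setU set2_side.
  case: (gap_chord (subxx (shorts E)) nab) => [z zab||->|]; rewrite ?eqxx //.
  - have : z \notin freepts E by apply/negP => /no; rewrite zab.
    by rewrite inE negbK => /exists_inP.
  - by move=> J JE; split; [move/freeptsP: aS | move/freeptsP: bS]; apply.
  - by rewrite inE => /andP[-> _]; rewrite orbT.
by apply/orP; left; apply/arc_disjP => z /freeptsP/(_ I IE).
Qed.

(** [p] and [q] are the neighbours in [S] of the missing vertex [z], so they are joined by a side or
    a diagonal. A side from [p] to [q] has no room for [z], and one from [q] to [p] would leave [S]
    with two vertices. *)
Lemma cell_gap S z : S \in cells E -> z \notin S -> exists p q,
  [/\ p \in S, q \in S, 0 < dist p z < dist p q,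
      forall s, s \in S -> ~~ (0 < dist p s < dist p q) & [set p; q] \in E].
Proof.
case/cellsP => S2 hS zS.
have [s0 s0S] : exists s, s \in S by apply/card_gt0P; move: S2; case: #|S|.
case: (@arg_minnP _ s0 (fun s => s \in S) (fun s => dist s z) s0S) => p pS pmin.
case: (@arg_minnP _ s0 (fun s => s \in S) (fun s => dist z s) s0S) => q qS qmin.
have zp : 0 < dist z p by apply: dist_neq; apply: contraNneq zS => ->.
have zq : 0 < dist z q by apply: dist_neq; apply: contraNneq zS => ->.
have npq : p != q.
  apply/negP => /eqP e; subst q; suff : #|S| <= 1 by clear -S2; lia.
  apply/card_le1_eqP => s t; suff eq1 r : r \in S -> r = p by move=> /eq1 -> /eq1 ->.
  move=> rS; have rz : 0 < dist z r by apply: dist_neq; apply: contraNneq zS => ->.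
  have := pmin r rS; have := qmin r rS => m1 m2; apply: (@dist_inj _ _ z).
  by clear pmin qmin S2 hS zS pS qS s0S; cyc z.
have zpq : 0 < dist p z < dist p q.
  have := qmin p pS; have npq' : dist z p <> dist z q by move/dist_inj => e;
    rewrite e eqxx in npq.
  by move=> m1; clear pmin qmin S2 hS zS pS qS s0S npq; cyc z.
have gap s : s \in S -> ~~ (0 < dist p s < dist p q).
  move=> sS; have := pmin s sS; have := qmin s sS => m1 m2.
  have zs : 0 < dist z s by apply: dist_neq; apply: contraNneq zS => ->.
  by clear pmin qmin S2 hS zS pS qS s0S npq sS; cyc z.
exists p, q; split=> //.
have : consecutive S p q by apply/orP; left; apply/arc_disjP.
rewrite hS // in_setU set2_side => /orP[/orP[/eqP h|/eqP h]|//]; exfalso.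
  by rewrite h in zpq; clear -zpq; lia.
have : S \subset [set p; q].
  apply/subsetP => s sS; have := gap s sS => g; rewrite !inE.
  have [//|nsp] := eqVneq s p; have [//|nsq] := eqVneq s q.
  have := dist_neq nsp; have := dist_neq nsq => d1 d2.
  by exfalso; clear gap sS nsp nsq zpq zp zq pmin qmin S2 hS zS pS qS s0S; cyc q.
by move/subset_leq_card; rewrite cards2 npq; move: S2; case: #|S| => [|[|[]]].
Qed.

Lemma cell_side S x y : S \in cells E -> x \in S -> y \in S -> x != y ->
  (forall s, s \in S -> ~~ (0 < dist y s < dist y x)) -> dist x y <= H ->
  (x, y) \in shorts E.
Proof.
case/cellsP => S2 hS xS yS nxy gap sh; rewrite inE /= sh andbT.
have : consecutive S x y by apply/orP; right; apply/arc_disjP.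
rewrite hS // in_setU set2_side => /orP[/orP[/eqP h|/eqP h]|//]; exfalso.
  have : S \subset [set x; y].
    apply/subsetP => s sS; have := gap s sS => g; rewrite !inE.
    have [//|nsx] := eqVneq s x; have [//|nsy] := eqVneq s y.
    have := dist_neq nsx; have := dist_neq nsy => d1 d2.
    by exfalso; clear gap sS nsx nsy S2 hS xS yS; cyc x.
  by move/subset_leq_card; rewrite cards2 nxy; move: S2; case: #|S| => [|[|[]]].
by clear S2 hS xS yS gap; cyc x.
Qed.

(** An end of the diagonal outside the cell lies in a gap, and the diagonal closing this gap would
    be crossed. If both ends belong to the cell, they are consecutive in it, so one side is
    empty. *)
Lemma cell_sep S u v a b : S \in cells E -> [set u; v] \in E ->
  a \in S -> b \in S -> 0 < dist u a < dist u v -> ~ dist u v < dist u b.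
Proof.
move=> SC uvE aS bS ha hb; have [S2 hS] := cellsP _ _ SC.
have [uS|/(cell_gap SC)[p [q [pS qS upq gap pqE]]]] := boolP (u \in S); last first.
  have g1 := gap a aS; have g2 := gap b bS.
  have n1 := E_noncross pqE uvE.
  by clear pS qS gap pqE S2 hS uvE; cyc p.
have [vS|/(cell_gap SC)[p [q [pS qS upq gap pqE]]]] := boolP (v \in S); last first.
  have g1 := gap a aS; have g2 := gap b bS.
  rewrite setUC in uvE; have n1 := E_noncross pqE uvE.
  by clear pS qS gap pqE S2 hS uvE; cyc p.
have nuv : u != v by apply/negP => /eqP e; rewrite e distxx in ha; clear -ha; lia.
have := hS u v uS vS nuv; rewrite in_setU uvE orbT => /orP[] /arc_disjP h.
  by have := h a aS; rewrite ha.
by have := h b bS => h'; clear h uvE hS S2; cyc u.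
Qed.

(** The distinction is whether two neighbours of the cell bound an arc of at most half a turn that
    contains the whole cell. If so the cell lies below that arc, otherwise it is the central one. *)
Lemma cell_cases S : S \in cells E ->
  (exists2 I, I \in shorts E & S = ucell E I) \/ S = freepts E.
Proof.
move=> SC; have [S2 hS] := cellsP _ _ SC.
have [/existsP[[x y]] |no] := boolP [exists I : V * V, [&& I.1 \in S, I.2 \in S,
  I.1 != I.2,
   dist I.1 I.2 <= H & arc I.2 I.1 :&: S == set0]].
  case/and5P; rewrite /= => xS yS nxy xyH /arc_disjP gap; left.
  have IE := cell_side SC xS yS nxy gap xyH; exists (x, y) => //.
  have [i1 i2 i3 i4] := shortsP IE; rewrite /= in i1 i2 i3 i4.
  apply/setP => z; apply/idP/idP => [zS|].
    rewrite !in_setU1 /=;  have [//|nzx] := eqVneq z x; have [//|nzy] := eqVneq z y.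
    have g := gap z zS; have := dist_neq nzx; have := dist_neq nzy => d1 d2.
    have zI : ins (x, y) z by rewrite /ins; clear gap zS nzx nzy S2 hS xS yS i1; cyc x.
    apply/mincellP; split=> // J JE Jz; have := shorts_nested IE JE zI Jz.
    case/orP => // JI; have [j1 j2 j3 j4] := shortsP JE.
    have s1 := cell_sep SC j1 zS xS Jz; have s2 := cell_sep SC j1 zS yS Jz.
    rewrite /subarc /ins /= in JI zI Jz *.
    by clear gap zS nzx nzy S2 hS xS yS i1 j1; cyc x.
  move=> zI; apply: contraT => /(cell_gap SC)[p [q [pS qS zpq gap' pqE]]].
  have g1 := gap p pS; have g2 := gap q qS; have g3 := gap' x xS; have g4 := gap' y yS.
  have zI' : ins (x, y) z.
    case: (ins_ucell IE zI) => [//|/= e]; exfalso.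
    by case: e => e; subst z; rewrite zpq in g3 g4.
  rewrite /ins /= in zI'.
  have [J1 J2] : dist x p <= dist x q /\ dist p q <= H.
    by clear gap gap' pS qS nxy zI S2 hS xS yS i1 pqE; split; cyc x.
  have JE : (p, q) \in shorts E by rewrite inE /= pqE.
  move: zI; rewrite !in_setU1 => /or3P[/eqP e|/eqP e|/mincellP[_ /(_ _ JE zpq)]].
  - by subst z; rewrite /= distxx in zI'.
  - by subst z; rewrite /= in zI'; move: zI'; clear; lia.
  rewrite /subarc /= => IJ.
  have [e1 e2] : dist x p = 0 /\ dist x q = dist x y.
    by clear gap gap' pS qS nxy S2 hS xS yS i1 pqE JE; split; cyc x.
  have ep : x = p by apply/eqP; rewrite -dist0 e1.
  have eq : q = y by apply: dist_inj e2.
  subst p q; exfalso.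
  have : S \subset [set x; y].
    apply/subsetP => s sS; have := gap s sS => k1; have := gap' s sS => k2; rewrite !inE.
    have [//|nsx] := eqVneq s x; have [//|nsy] := eqVneq s y.
    have := dist_neq nsx; have := dist_neq nsy => d1 d2.
    exfalso; clear gap gap' sS nsx nsy S2 hS xS yS pS qS JE i1 pqE.
    clear -k1 k2 d1 d2 i2; cyc x.
  by move/subset_leq_card; rewrite cards2 nxy; move: S2; case: #|S| => [|[|[]]].
right.
have noI x y : x \in S -> y \in S -> x != y -> dist x y <= H ->
    (forall s, s \in S -> ~~ (0 < dist y s < dist y x)) -> False.
  move=> xS yS nxy xyH /arc_disjP g; case/negP: no; apply/existsP; exists (x, y).
  exact/and5P.
apply/setP => z; apply/idP/idP => [zS|zU].
  (* An arc covering one vertex of the cell would contain the whole cell by [cell_sep], and the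
     extreme vertices of the cell along it would be an excluded pair. *)
  apply/freeptsP => -[u v] JE; apply/negP => zJ; have [j1 j2 j3 j4] := shortsP JE.
  rewrite /ins /= in zJ j1 j2 j3 j4.
  have sub s : s \in S -> dist u s <= dist u v.
    by move=> sS; have := cell_sep SC j1 zS sS zJ; clear; lia.
  case: (@arg_minnP _ z (fun s => s \in S) (fun s => dist u s) zS) => x xS xmin.
  case: (@arg_maxnP _ z (fun s => s \in S) (fun s => dist u s) zS) => y yS ymax.
  have nxy : x != y.
    apply/negP => /eqP e; subst y; suff : #|S| <= 1 by clear -S2; lia.
    apply/card_le1_eqP => s t; suff eq1 r : r \in S -> r = x by move=> /eq1 -> /eq1 ->.
    move=> rS; apply: (@dist_inj _ _ u); have := xmin r rS; have := ymax r rS; clear; lia.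
  have l1 := ymax x xS; have l2 := sub y yS.
  apply: (noI x y) => //; first by clear noI no sub xmin ymax nxy S2 hS j1; cyc u.
  move=> s sS; have := xmin s sS; have := ymax s sS => l3 l4.
  have := dist_neq nxy => d1.
  by clear noI no sub xmin ymax nxy S2 hS j1; cyc u.
apply: contraT => /(cell_gap SC)[p [q [pS qS zpq gap pqE]]]; exfalso.
case: (leqP (dist p q) H) => l.
  have JE : (p, q) \in shorts E by rewrite inE /= pqE.
  by move/freeptsP: zU => /(_ _ JE); rewrite /ins /= zpq.
have npq : q != p by apply/negP => /eqP e; rewrite e distxx in zpq; clear -zpq; lia.
apply: (noI q p) => //; clear noI no zU gap npq; cyc p.
Qed.

(** The delicate case is a diameter in its two orientations: both cells contain its ends, but
    positive weight gives each a further vertex on its own side. *)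
Lemma ucell_inj : {in shorts E &, injective (ucell E)}.
Proof.
suff key x y u v : (x, y) \in shorts E -> (u, v) \in shorts E ->
    ucell E (x, y) = ucell E (u, v) -> (x, y) = (u, v).
  by move=> [x y] [u v]; apply: key.
move=> IE JE e.
have [i1 i2 i3 i4] := shortsP IE; have [j1 j2 j3 j4] := shortsP JE.
have bnd p q z : (p, q) \in shorts E -> z \in ucell E (p, q) -> dist p z <= dist p q.
  by move=> KE /(ins_ucell KE) [/andP[_ /ltnW]|[->|->]]; rewrite ?distxx.
have mem p q : p \in ucell E (p, q) /\ q \in ucell E (p, q) by rewrite !inE !eqxx ?orbT.
have [mI1 mI2] := mem x y; have [mJ1 mJ2] := mem u v.
rewrite e in mI1 mI2; have b3 := bnd _ _ _ JE mI1; have b4 := bnd _ _ _ JE mI2.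
rewrite -e in mJ1 mJ2; have b5 := bnd _ _ _ IE mJ1; have b6 := bnd _ _ _ IE mJ2.
rewrite /= in i1 i2 i3 i4 j1 j2 j3 j4.
have [d|d] := eqVneq (dist x u) 0.
  have e1 : x = u by apply/eqP; rewrite -dist0 d.
  by subst u; congr pair; apply: (@dist_inj _ _ x); apply/eqP; rewrite eqn_leq b4 b6.
have e1 : u = y.
  by apply: (@dist_inj _ _ x); clear bnd mem mI1 mI2 mJ1 mJ2 i1 j1 e IE JE; cyc x.
have e2 : v = x.
  by apply/eqP; rewrite eq_sym -dist0; clear bnd mem mI1 mI2 mJ1 mJ2 i1 j1 e IE JE;
    subst u; cyc x.
subst u v; have := arcwt_gt0 IE; rewrite /arcwt => /card_gt0P[z zI].
have : z \in ucell E (y, x) by rewrite -e !inE; move: zI; rewrite inE => ->;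
  rewrite !orbT.
move/(bnd _ _ _ JE); case/mincellP: zI; rewrite /ins /= => zI _.
by clear bnd mem mI1 mI2 mJ1 mJ2 i1 j1 b3 b4 b5 b6 e IE JE => zJ; cyc x.
Qed.

Lemma ucell_neq_free I : I \in shorts E -> ucell E I != freepts E.
Proof.
move=> IE; have := arcwt_gt0 IE; rewrite /arcwt => /card_gt0P[z zI].
apply/negP => /eqP/setP/(_ z); rewrite !in_setU1 zI !orbT => /esym/freeptsP/(_ I IE).
by case/mincellP: zI => ->.
Qed.

Lemma cellsE : cells E = ucell E @: shorts E :|: [set S | (S == freepts E) && (2 < #|S|)].
Proof.
apply/setP => S; rewrite in_setU [in RHS]inE; apply/idP/idP.
  move=> SC; case: (cell_cases SC) => [[I IE ->]|e]; first by rewrite imset_f.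
  by apply/orP; right; rewrite -e eqxx; case/cellsP: SC.
case/orP => [/imsetP[I IE ->]|/andP[/eqP e S2]]; first exact: ucell_cell.
by rewrite e; apply: free_cell; rewrite -e.
Qed.

Lemma card_cells k : 0 < k ->
  #|[set S in cells E | #|S| == k + 2]| =
  #|[set I in shorts E | arcwt E I == k]| + (#|freepts E| == k + 2).
Proof.
move=> k0.
have -> : [set S in cells E | #|S| == k + 2] =
   ucell E @: [set I in shorts E | arcwt E I == k] :|: [set S | (S == freepts E) &&
     (#|S| == k + 2)].
  apply/setP => S; rewrite cellsE !inE; apply/idP/idP.
    case/andP => /orP[/imsetP[I IE ->]|/andP[-> _] ->]; last by rewrite orbT.
    rewrite card_ucell // addn2 !eqSS => wI; apply/orP; left; apply/imsetP;
      exists I => //.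
    by rewrite inE IE.
  case/orP => [/imsetP[I]|/andP[-> h]]; last by rewrite h; apply/andP; split=> //;
    apply/orP; right; lia.
  rewrite inE => /andP[IE /eqP wI] ->; rewrite card_ucell // wI addn2 eqxx andbT.
  by apply/orP; left; apply: imset_f.
rewrite cardsU (_ : _ :&: _ = set0) ?cards0 ?subn0; last first.
  apply/setP => S; rewrite !inE; apply/negP => /andP[/imsetP[I]].
  rewrite inE => /andP[IE _] -> /andP[h _].
  by have := ucell_neq_free IE; rewrite h.
rewrite card_in_imset; last first.
  by move=> I J; rewrite !inE => /andP[IE _] /andP[JE _]; apply: ucell_inj; rewrite inE.
congr (_ + _); case: eqP => h.
  rewrite (_ : [set S | _] = [set freepts E]) ?cards1 //; apply/setP => S; rewrite !inE.
  by case: eqP => // ->; rewrite h eqxx.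
rewrite (_ : [set S | _] = set0) ?cards0 //; apply/setP => S; rewrite !inE.
by case: eqP => // ->; apply/eqP.
Qed.

(** Divisibility for the central cell follows from the others: its size minus 2 is 2mn minus the sum
    of all weights. *)
Lemma m_divisible_wt :
  m_divisible E = [forall I in shorts E, m %| arcwt E I].
Proof.
apply/forall_inP/forall_inP => h.
  by move=> I IE; have := h _ (ucell_cell IE); rewrite card_ucell // -addn2 addnK.
move=> S /cell_cases[[I IE ->]|->]; first by rewrite card_ucell // -addn2 addnK; apply: h.
have dv : m %| \sum_(I in shorts E) arcwt E I by apply: dvdn_sum.
have := sum_arcwt => e.
have -> : #|freepts E| - 2 = 2 * m * n - \sum_(I in shorts E) arcwt E I.
  move: e (cardV m n); move: (\sum_(I in _) _) #|freepts E| => A B; clear; lia.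
by apply: dvdn_sub => //; rewrite -mulnA mulnCA dvdn_mulr.
Qed.

(** The length minus 1 is the sum of the weights at and below an arc; induction on the length
    isolates the weight of the arc itself. *)
Lemma m_divisible_len :
  m_divisible E = [forall I in shorts E, m %| (dist I.1 I.2).-1].
Proof.
rewrite m_divisible_wt; apply/forall_inP/forall_inP => h I IE.
  by rewrite -(sum_arcwt_sub IE); apply: dvdn_sum => J /andP[JE _]; apply: h.
move: {2}(dist _ _).+1 (ltnSn (dist I.1 I.2)) => k; elim: k I IE => // k IH I IE hk.
have := h I IE; rewrite -(sum_arcwt_sub IE) (bigD1 I) /=; last first.
  by rewrite IE /subarc distxx leqnn.
rewrite dvdn_addl //; apply: dvdn_sum => J /andP[/andP[JE JI] nJI].
apply: IH => //; case: (subarc_mono JE IE JI) => [e|]; first by rewrite e eqxx in nJI.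
by move=> lt; apply: leq_trans lt _; rewrite -ltnS.
Qed.

End OneDissection.
Unset Default Proof Using.
End Arcs.
Arguments ins {m n} I z : rename.
Arguments subarc {m n} I J : rename.

(** * Periodic dissections *)

Section Rotation.
Variables m n : nat.
Local Notation V := (vertex m n).
Local Notation H := (halfgon m n).
Implicit Types (x y z u v a b c g p q o : V) (I J : V * V) (S d e : {set V}) (E :
  {set {set V}}).

Definition rotd g d : {set V} := [set (x + g)%R | x in d].
Definition rotE g E : {set {set V}} := [set rotd g d | d in E].
Definition rotp g I : V * V := ((I.1 + g)%R, (I.2 + g)%R).

Lemma rotd2 g x y : rotd g [set x; y] = [set (x + g)%R; (y + g)%R].
Proof. by rewrite /rotd imsetU1 imset_set1. Qed.

Lemma rotdD g h d : rotd g (rotd h d) = rotd (h + g)%R d.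
Proof. by rewrite /rotd -imset_comp; apply: eq_imset => x /=; rewrite addrA. Qed.

Lemma rotd0 d : rotd 0%R d = d.
Proof. by rewrite /rotd (eq_imset _ (@addr0 _)) imset_id. Qed.

Lemma rotdK g : cancel (rotd g) (rotd (- g)%R).
Proof. by move=> d; rewrite rotdD subrr rotd0. Qed.

Lemma rotED g h E : rotE g (rotE h E) = rotE (h + g)%R E.
Proof. by rewrite /rotE -imset_comp; apply: eq_imset => d /=; rewrite rotdD. Qed.

Lemma rotE0 E : rotE 0%R E = E.
Proof. by rewrite /rotE (eq_imset _ rotd0) imset_id. Qed.

Lemma mem_rotE g d E : (rotd g d \in rotE g E) = (d \in E).
Proof. by rewrite mem_imset //; apply: can_inj (rotdK g). Qed.

Lemma mem_rotE2 g x y E :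
  ([set (x + g)%R; (y + g)%R] \in rotE g E) = ([set x; y] \in E).
Proof. by rewrite -rotd2 mem_rotE. Qed.

Lemma dist_rot g x y : dist (x + g)%R (y + g)%R = dist x y.
Proof. by rewrite /dist opprD addrACA subrr addr0. Qed.

Lemma rotpK g : cancel (rotp g) (rotp (- g)%R).
Proof. by case=> x y; rewrite /rotp /= !addrK. Qed.

Lemma rotpNK g : cancel (rotp (- g)%R) (rotp g).
Proof. by case=> x y; rewrite /rotp /= !subrK. Qed.

Lemma shorts_rot g I E : (rotp g I \in shorts (rotE g E)) = (I \in shorts E).
Proof. by rewrite !inE /= mem_rotE2 dist_rot. Qed.

Lemma ins_rot g I z : ins (rotp g I) (z + g)%R = ins I z.
Proof. by rewrite /ins /= !dist_rot. Qed.

Lemma subarc_rot g I J : subarc (rotp g I) (rotp g J) = subarc I J.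
Proof. by rewrite /subarc /= !dist_rot. Qed.

Lemma freepts_rot g z E : ((z + g)%R \in freepts (rotE g E)) = (z \in freepts E).
Proof.
apply/freeptsP/freeptsP => h I IE.
  by rewrite -(ins_rot g); apply: h; rewrite shorts_rot.
by rewrite -(rotpNK g I) ins_rot; apply: h; rewrite -(shorts_rot g) rotpNK.
Qed.

Lemma arcwt_rot g I E : arcwt (rotE g E) (rotp g I) = arcwt E I.
Proof.
rewrite /arcwt -[RHS](card_imset _ (addIr g)); apply: eq_card => z.
rewrite -[z](subrK g) (mem_imset _ _ (addIr g)).
apply/mincellP/mincellP => -[zI h]; rewrite ?ins_rot in zI *; split=> // J JE.
  by move=> Jz; rewrite -(subarc_rot g); apply: h; rewrite ?shorts_rot ?ins_rot.
rewrite -(rotpNK g J) in JE *; rewrite shorts_rot in JE.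
by rewrite ins_rot subarc_rot; apply: h.
Qed.

Lemma card_arcwt_rot g E w :
  #|[set I in shorts (rotE g E) | arcwt (rotE g E) I == w]| =
  #|[set I in shorts E | arcwt E I == w]|.
Proof.
rewrite -[RHS](card_imset _ (can_inj (rotpK g))); apply: eq_card => I.
rewrite -(rotpNK g I) (mem_imset _ _ (can_inj (rotpK g))).
by rewrite [LHS]in_set shorts_rot arcwt_rot [RHS]in_set.
Qed.

Lemma mem_diagonals2 x y :
  ([set x; y] \in diagonals m n) = (1 < dist x y) && (1 < dist y x).
Proof.
rewrite inE set2_side cards2 -(dist0 x y); have := dist0 y x; have := dist0 x y.
by rewrite (eq_sym y) => <-; lia.
Qed.

Lemma diagonal_pair d : d \in diagonals m n -> exists x y, d = [set x; y].
Proof. by rewrite inE => /andP[/cards2P[x [y [_ ->]]] _]; exists x, y. Qed.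

Lemma diagonals_rot g E : E \subset diagonals m n -> rotE g E \subset diagonals m n.
Proof.
move=> /subsetP Ed; apply/subsetP => _ /imsetP[d /Ed dd ->].
by have [x [y e]] := diagonal_pair dd; rewrite e in dd *;
  rewrite rotd2 mem_diagonals2 !dist_rot -mem_diagonals2.
Qed.

Lemma noncrossingI E :
    (forall x y u v, [set x; y] \in E -> [set u; v] \in E ->
       ~ (0 < dist x u < dist x y /\ dist x y < dist x v)) ->
    E \subset diagonals m n -> noncrossing E.
Proof.
move=> h /subsetP Ed; apply/forall_inP => d dE; apply/forall_inP => e eE; apply/negP.
case/exists_inP => x xd /exists_inP[y yd] /andP[/set0Pn[u] + /set0Pn[v]].
rewrite !in_setI !in_arc => /andP[hu ue] /andP[hv ve].
have dxy : d = [set x; y].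
  have [p [q e1]] := diagonal_pair (Ed _ dE); rewrite e1 in xd yd *.
  case/set2P: xd hu hv => ->; case/set2P: yd => -> //; rewrite ?distxx //; try lia.
  by rewrite setUC.
have euv : e = [set u; v].
  have [p [q e1]] := diagonal_pair (Ed _ eE); rewrite e1 in ue ve *.
  case/set2P: ue hu hv => ->; case/set2P: ve => -> //; try by rewrite setUC.
    by move=> h1 h2; exfalso; cyc x.
  by move=> h1 h2; exfalso; cyc x.
rewrite dxy in dE; rewrite euv in eE; apply: (h _ _ _ _ dE eE); split=> //.
by clear dE eE h Ed; cyc x.
Qed.

Lemma noncrossing_rot g E : E \subset diagonals m n -> noncrossing E ->
  noncrossing (rotE g E).
Proof.
move=> Ed Enc; apply: noncrossingI; last exact: diagonals_rot.
move=> x y u v; rewrite -[x](subrK g) -[y](subrK g) -[u](subrK g) -[v](subrK g).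
rewrite !mem_rotE2 !dist_rot.
by move=> h1 h2; have := E_noncross Ed Enc h1 h2; rewrite !dist_rot.
Qed.

Definition periodic g E := rotE g E = E.

Lemma periodicD g h E : periodic g E -> periodic h E -> periodic (g + h)%R E.
Proof. by rewrite /periodic -rotED => -> ->. Qed.

Lemma periodicMn g k E : periodic g E -> periodic (g *+ k)%R E.
Proof.
move=> pg; elim: k => [|k IH]; first by rewrite /periodic mulr0n rotE0.
by rewrite mulrS; apply: periodicD.
Qed.

Lemma val_natV k : (k%:R : V)%R = k %% (2 * H) :> nat.
Proof. by rewrite -cardV Zp_nat. Qed.

Lemma natVK x : ((nat_of_ord x)%:R : V)%R = x.
Proof. by apply/val_inj; rewrite /= val_natV modn_small // -cardV. Qed.

Lemma dist0x x : dist (0 : V)%R x = x.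
Proof. by rewrite /dist subr0. Qed.

Lemma distD o c x :
  (dist o c + x < 2 * H /\ dist o (c + x)%R = dist o c + x) \/
  (2 * H <= dist o c + x /\ dist o (c + x)%R + 2 * H = dist o c + x).
Proof.
have e : dist o (c + x)%R = (dist o c + x) %% (2 * H).
  by rewrite -cardV /dist -addrA [(x - o)%R]addrC addrA.
have h1 := dist_lt o c; have h2 := ltn_ord x.
have h3 : x < 2 * H by rewrite -cardV.
rewrite e; case: (ltnP (dist o c + x) (2 * H)) => h; [left|right]; split=> //.
  by rewrite modn_small.
rewrite -{2}[dist o c + x](subnK h) -[X in X %% _](subnK h) modnDr modn_small //.
by lia.
Qed.

Lemma periodic_dvd N c E : periodic (N%:R : V)%R E -> N %| c -> periodic c E.
Proof.
move=> pN /dvdnP[k e]; rewrite -[c]natVK e (mulnC k N) mulrnA.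
exact: periodicMn.
Qed.

(** * The fundamental domain of a periodic dissection *)

Section Period.
Variable N : nat.
Hypotheses (N_gt0 : 0 < N) (N_dvdH : N %| H).
Local Notation D := (2 * H %/ N).

Let NH : N <= H. Proof. exact: dvdn_leq. Qed.
Let DN : D * N = 2 * H. Proof. by rewrite divnK // dvdn_mull. Qed.
Let valN : (N%:R : V)%R = N :> nat.
Proof. by rewrite val_natV modn_small //; move: NH; rewrite /halfgon; lia. Qed.

(* The arcs that start in the fundamental domain [0, N). *)
Definition fund E : {set V * V} := [set I in shorts E | I.1 < N].

(** The arcs that start in [kN, kN + N) are the translates by kN of those that start in [0, N). *)
Lemma card_periodic E w : periodic (N%:R : V)%R E ->
  #|[set I in shorts E | arcwt E I == w]| =
  D * #|[set I in fund E | arcwt E I == w]|.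
Proof.
move=> pE.
have D0 : 0 < D by rewrite divn_gt0 //; move: NH; clear; lia.
pose f I : 'I_D := insubd (Ordinal D0) (I.1 %/ N).
have fE I : f I = I.1 %/ N :> nat.
  have lt : I.1 %/ N < D by rewrite ltn_divLR // DN -cardV ltn_ord.
  by rewrite /f val_insubd lt.
rewrite -sum1_card (partition_big f xpredT) //= -[X in _ = X * _]card_ord -sum_nat_const.
apply: eq_bigr => k _; rewrite sum1_card.
have kN : k * N + N <= 2 * H.
  by rewrite -mulSnr; apply: leq_trans (leq_mul (ltn_ord k) (leqnn N)) _; rewrite DN.
pose c : V := (k * N)%:R%R.
have valc : c = k * N :> nat by rewrite val_natV modn_small //; move: kN N_gt0;
  clear; lia.
have pc : periodic c E by apply: periodic_dvd pE _; rewrite valc dvdn_mull.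
rewrite -[RHS](card_imset _ (can_inj (rotpK c))); apply: eq_card => I.
rewrite -(rotpNK c I); move: (rotp _ I) => {I} J;
  rewrite (mem_imset _ _ (can_inj (rotpK c))).
have sJ : (rotp c J \in shorts E) = (J \in shorts E) by rewrite -{1}pc shorts_rot.
have wJ : arcwt E (rotp c J) = arcwt E J by rewrite -{1}pc arcwt_rot.
rewrite unfold_in /= in_set [in RHS]in_set [J \in fund E]in_set sJ wJ.
rewrite -andbA -andbA; congr (_ && _); rewrite andbC; congr (_ && _).
have -> : (f (rotp c J) == k) = ((J.1 + c)%R %/ N == k) by rewrite -val_eqE;
  congr (_ == _); apply: fE.
have := distD 0%R J.1 c; rewrite !dist0x valc.
have lJ : J.1 < 2 * H by case: (distP J.1 J.1).
move: ((J.1 + c)%R : nat) => r.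
case: (ltnP J.1 N) => hJ.
  case=> -[h1 h2]; last by exfalso; move: h1 hJ kN; clear; lia.
  by rewrite h2 addnC divnMDl // (divn_small hJ) addn0 eqxx.
move=> h; apply/negbTE/eqP => e.
have := divn_eq r N; have := ltn_mod r N; rewrite e N_gt0.
by case: h => -[h1 h2]; move: h1 h2 hJ kN lJ; clear; lia.
Qed.

(** This is the cut: vertex 0 is free, hence [N] is free by periodicity, and an arc that starts in
    [0, N) cannot pass over it. *)
Lemma shorts_fund E I : E \subset diagonals m n -> noncrossing E ->
    periodic (N%:R : V)%R E -> 0%R \in freepts E -> I \in fund E ->
  I.1.+1 < I.2 /\ I.2 <= N.
Proof.
move=> Ed Enc pE fE; rewrite inE => /andP[IE lI].
have fN : (N%:R : V)%R \in freepts E.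
  by rewrite -{1}pE -{1}[(N%:R)%R]add0r freepts_rot.
have [_ h1 h2 h3] := shortsP Ed Enc IE.
have := freeptsP _ _ fE _ IE; have := freeptsP _ _ fN _ IE; rewrite /ins.
have v0 := dist0x (N%:R)%R; rewrite valN in v0.
have v1 := dist0x I.1; have v2 := dist0x I.2.
case: I IE lI h1 h2 h3 v1 v2 => x y /= IE lI h1 h2 h3 <- <- f1 f2; rewrite -dist0x in lI.
have hN := NH; have hN0 := N_gt0.
set t : V := (N%:R)%R in v0 f1 *.
set o : V := 0%R in v0 f1 f2 lI *.
clear IE fE fN pE Enc Ed; clearbody t o.
by cyc o.
Qed.

Lemma linfam_fund E : E \subset diagonals m n -> noncrossing E ->
    periodic (N%:R : V)%R E -> 0%R \in freepts E -> linfam N (fund E).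
Proof.
move=> Ed Enc pE fE; apply/linfamP => I IE.
have [h1 h2] := shorts_fund Ed Enc pE fE IE; split=> // J JE.
have [h3 h4] := shorts_fund Ed Enc pE fE JE.
move: IE JE; rewrite ![_ \in fund E]inE => /andP[IE lI] /andP[JE lJ].
have [n1 _] := shorts_noncross Ed Enc IE JE.
case: I J IE JE {lI lJ} h1 h2 h3 h4 n1 => x y [u v] /= IE JE h1 h2 h3 h4 n1 [c1 c2 c3].
have v1 := dist0x x; have v2 := dist0x y; have v3 := dist0x u; have v4 := dist0x v.
rewrite -v1 -v2 -v3 -v4 in h1 h2 h3 h4 c1 c2 c3; apply: n1;
  set o : V := 0%R in h1 h2 h3 h4 c1 c2 c3.
clear IE JE v1 v2 v3 v4 fE pE Enc Ed; clearbody o.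
by cyc o.
Qed.

(** An arc that covers an inner vertex of [I] starts in [0, N) too, as it cannot pass over the free
    vertex 0. Smallest enclosing arcs may thus be sought in the fundamental domain. *)
Lemma weight_fund E I : E \subset diagonals m n -> noncrossing E ->
    periodic (N%:R : V)%R E -> 0%R \in freepts E -> I \in fund E ->
  weight (fund E) I = arcwt E I.
Proof.
move=> Ed Enc pE fE IE.
have [h1 h2] := shorts_fund Ed Enc pE fE IE.
have subE J : J \in fund E -> subint I J = subarc I J.
  move=> JE; have [h3 h4] := shorts_fund Ed Enc pE fE JE; rewrite /subint /subarc.
  case: I J {IE JE} h1 h2 h3 h4 => x y [u v] /=.
  rewrite -(dist0x x) -(dist0x y) -(dist0x u) -(dist0x v); set o : V := 0%R; clearbody o.
  by clear fE pE Enc Ed => h1 h2 h3 h4; cyc o.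
have insE J z : J \in fund E -> inside J z = ins J z.
  move=> JE; have [h3 h4] := shorts_fund Ed Enc pE fE JE; rewrite /inside /ins.
  case: J {JE} h3 h4 => u v /=.
  rewrite -(dist0x u) -(dist0x v) -(dist0x z); set o : V := 0%R; clearbody o.
  by clear subE fE pE Enc Ed => h3 h4; cyc o.
apply: eq_card => z; apply/mincellP/mincellP => -[Iz h].
  rewrite insE // in Iz; split=> // J JE Jz.
  have JF : J \in fund E.
    rewrite [_ \in fund E]inE JE /=; have [_ j1 j2 j3] := shortsP Ed Enc JE.
    have := freeptsP _ _ fE _ JE; move: Iz Jz; rewrite /ins.
    case: I J {IE subE insE JE h} h1 h2 j1 j2 j3 => x y [u v] /=; have hN0 := N_gt0.
    rewrite -(dist0x x) -(dist0x y) -(dist0x u); set o : V := 0%R; clearbody o.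
    by clear fE pE Enc Ed => h1 h2 j1 j2 j3 h3 h4 h5; cyc o.
  by rewrite -subE //; apply: h; rewrite ?insE.
rewrite insE //; split=> // J JE Jz; rewrite subE //; rewrite insE // in Jz.
by apply: h => //; move: JE; rewrite [_ \in fund E]inE => /andP[].
Qed.

Definition unfund (P : {set V * V}) : {set {set V}} :=
  [set [set (p.1.1 + p.2)%R; (p.1.2 + p.2)%R] | p in setX P [set c : V | N %| c]].

Lemma unfundP (P : {set V * V}) d :
  reflect (exists I c, [/\ I \in P, N %| c & d = [set (I.1 + c)%R; (I.2 + c)%R]])
    (d \in unfund P).
Proof.
apply: (iffP imsetP) => [[[I c] /=]|[I [c [IP cN ->]]]].
  by rewrite in_setX in_set /= => /andP[IP cN] ->; exists I, c.
by exists (I, c) => //; rewrite in_setX in_set /= IP cN.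
Qed.

Lemma fundK E : E \subset diagonals m n -> noncrossing E ->
  periodic (N%:R : V)%R E -> unfund (fund E) = E.
Proof.
move=> Ed Enc pE; apply/setP => d; apply/unfundP/idP.
  move=> [I [c [IP cN ->]]]; have pc := periodic_dvd pE cN.
  move: IP; rewrite inE => /andP[+ _]; rewrite inE => /andP[IE _].
  by rewrite -pc mem_rotE2.
case/(E_pair Ed Enc) => -[x y] [IE ->] /=.
pose c : V := (x %/ N * N)%:R%R.
have lx : x < 2 * H by case: (distP x x).
have valc : c = x %/ N * N :> nat.
  by rewrite val_natV modn_small //; apply: leq_ltn_trans lx; rewrite leq_trunc_div.
have cN : N %| c by rewrite valc dvdn_mull.
have pc := periodic_dvd pE cN.
exists (rotp (- c)%R (x, y)), c; split=> //; last by rewrite /= !subrK.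
rewrite inE -(shorts_rot c) pc rotpNK IE andTb; change ((x - c)%R < N).
have := distD 0%R (x - c)%R c; rewrite subrK !dist0x valc.
have := divn_eq x N; have := ltn_mod x N; rewrite N_gt0.
have lr : (x - c)%R < 2 * H by case: (distP (x - c)%R x).
move: ((x - c)%R : nat) (x %% N) (x %/ N * N) lr lx => r s q; clear; lia.
Qed.

Lemma dvd_sep a b : N %| a -> N %| b -> [\/ a = b, a + N <= b | b + N <= a].
Proof.
move=> /dvdnP[i ea] /dvdnP[j eb].
case: (ltngtP i j) => [ij|ij|ij].
- by constructor 2; rewrite ea eb -mulSnr leq_mul2r ij orbT.
- by constructor 3; rewrite ea eb -mulSnr leq_mul2r ij orbT.
- by constructor 1; apply/val_inj; rewrite /= ea eb ij.
Qed.

Lemma dvd_top a : N %| a -> a + N <= 2 * H.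
Proof.
move=> /dvdnP[i ea]; have la : a < 2 * H by case: (distP a a).
rewrite ea in la *; rewrite -DN -mulSnr leq_mul2r; apply/orP; right.
by rewrite -DN ltn_mul2r in la; case/andP: la.
Qed.

(** Only the right end of a translate can wrap around, and only onto vertex 0. *)
Lemma unfund_pos (P : {set V * V}) x y c : linfam N P -> (x, y) \in P -> N %| c ->
  [/\ x.+1 < y, y <= N, c + N <= 2 * H, dist 0%R (x + c)%R = x + c &
      dist 0%R (y + c)%R = y + c \/ y + c = 2 * H /\ dist 0%R (y + c)%R = 0].
Proof.
move=> /linfamP PP IP cN; have [/= h1 h2 _] := PP _ IP; have h3 := dvd_top cN.
have := distD 0%R x c; have := distD 0%R y c; rewrite !dist0x => d1 d2.
have := dist_lt 0%R (y + c)%R; rewrite dist0x.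
move: d1 d2; move: ((x + c)%R : nat) ((y + c)%R : nat) => r s d1 d2 l.
by split=> //; move: d1 d2 h1 h2 h3 l N_gt0; clear; lia.
Qed.

Lemma unfund_diag (P : {set V * V}) : linfam N P -> unfund P \subset diagonals m n.
Proof.
move=> hP; apply/subsetP => d /unfundP[[x y] [c [IP cN ->]]] /=.
have [h1 h2 h3 h4 h5] := unfund_pos hP IP cN; have hN := NH.
rewrite mem_diagonals2; move: h4 h5 hN; set o : V := 0%R; clearbody o.
move: (x + c)%R (y + c)%R => p q.
by clear -h1 h2 h3 => h4 h5 hN; cyc o.
Qed.

(** The four linear orders obtained by cutting the cyclic order p, r, q, s at [o]. *)
Lemma cross_pos o p q r s : 0 < dist p r < dist p q /\ dist p q < dist p s ->
  [\/ [/\ dist o p < dist o r, dist o r < dist o q & dist o q < dist o s],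
      [/\ dist o r < dist o q, dist o q < dist o s & dist o s < dist o p],
      [/\ dist o q < dist o s, dist o s < dist o p & dist o p < dist o r] |
      [/\ dist o s < dist o p, dist o p < dist o r & dist o r < dist o q]].
Proof.
move=> h; have : dist o p < dist o r /\ dist o r < dist o q /\ dist o q < dist o s \/
  dist o r < dist o q /\ dist o q < dist o s /\ dist o s < dist o p \/
  dist o q < dist o s /\ dist o s < dist o p /\ dist o p < dist o r \/
  dist o s < dist o p /\ dist o p < dist o r /\ dist o r < dist o q by cyc o.
by case=> [[? []]|[[? []]|[[? []]|[? []]]]];
  [constructor 1|constructor 2|constructor 3|constructor 4].
Qed.

(** Translates by the same multiple of [N] cross no more than in [P]; translates by different
    multiples lie in blocks that share no inner vertex. *)
Lemma unfund_nc (P : {set V * V}) : linfam N P -> noncrossing (unfund P).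
Proof.
move=> hP; apply: noncrossingI; last exact: unfund_diag.
have set2E (p q r s : V) : [set p; q] = [set r;
  s] -> (p = r /\ q = s) \/ (p = s /\ q = r).
  move=> e; have h1 : p \in [set r; s] by rewrite -e !inE eqxx.
  have h2 : q \in [set r; s] by rewrite -e !inE eqxx orbT.
  have h3 : r \in [set p; q] by rewrite e !inE eqxx.
  have h4 : s \in [set p; q] by rewrite e !inE eqxx orbT.
  case/set2P: h1 h2 h3 h4 => -> /set2P[] ->; rewrite !inE ?orbb; try by tauto.
    by move=> _ /eqP ->; left.
  by move=> /eqP ->; left.
move=> p q r s /unfundP[[x y] [c [IP cN /set2E e1]]] /unfundP[[u v] [e [JP eN /set2E
  e2]]].
have [h1 h2 h3 h4 h5] := unfund_pos hP IP cN;
  have [k1 k2 k3 k4 k5] := unfund_pos hP JP eN.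
have hN := NH.
have n1 := linfamP _ _ hP.
have [/= _ _ /(_ _ JP) /= c1] := n1 _ IP; have [/= _ _ /(_ _ IP) /= c2] := n1 _ JP.
have {}c1 : ~ (x < u /\ u < y /\ y < v) by move=> [? [? ?]]; apply: c1.
have {}c2 : ~ (u < x /\ x < v /\ v < y) by move=> [? [? ?]]; apply: c2.
have sep : c = e :> nat \/ c + N <= e \/ e + N <= c.
  by case: (dvd_sep cN eN) => [->|?|?]; auto.
rewrite /= in e1 e2.
move: h4 h5 k4 k5 e1 e2; move: (x + c)%R (y + c)%R (u + e)%R (v + e)%R => p' q' r' s'.
set o : V := 0%R; clearbody o.
clear n1 set2E IP JP cN eN hP.
move: (nat_of_ord x) (nat_of_ord y) (nat_of_ord u) (nat_of_ord v) (nat_of_ord c)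
  (nat_of_ord e)
  h1 h2 h3 k1 k2 k3 hN c1 c2 sep =>
    X Y U W C F h1 h2 h3 k1 k2 k3 hN c1 c2 sep h4 h5 k4 k5.
move=> e1 e2 /(cross_pos o).
have {}h5 : dist o q' = Y + C \/ Y + C = 2 * H /\ dist o q' = 0 by tauto.
have {}k5 : dist o s' = W + F \/ W + F = 2 * H /\ dist o s' = 0 by tauto.
case: e1 => -[-> ->]; case: e2 => -[-> ->]; rewrite h4 k4;
  move: (dist_lt o q') (dist_lt o s');
  case: h5 => [->|[h5 ->]]; case: k5 => [->|[k5 ->]] b1 b2;
  case: sep => [sp|[sp|sp]] [] [g1 g2 g3]; try subst F; lia.
Qed.

Lemma unfund_periodic (P : {set V * V}) : periodic (N%:R : V)%R (unfund P).
Proof.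
apply/eqP; rewrite eqEcard [X in _ <= X]card_imset ?leqnn ?andbT;
  last exact: can_inj (rotdK _).
apply/subsetP => _ /imsetP[d /unfundP[[x y] [c [IP cN ->]]] ->]; apply/unfundP.
exists (x, y), (c + N%:R)%R; split=> //; last by rewrite rotd2 !addrA.
have := distD 0%R c (N%:R)%R; rewrite !dist0x valN => -[] [_ h];
  first by rewrite h dvdn_addr.
have : N %| (c + N%:R)%R + 2 * H by rewrite h dvdn_addr.
by rewrite dvdn_addl // dvdn_mull.
Qed.

Lemma shorts_unfund (P : {set V * V}) I : linfam N P -> I \in shorts (unfund P) ->
  exists J c, [/\ J \in P, N %| c & I = rotp c J].
Proof.
move=> hP; case: I => p q; rewrite inE /= => /andP[/unfundP[[x y] [c [IP cN e]]] pqH].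
have [h1 h2 h3 h4 h5] := unfund_pos hP IP cN.
have hp : p \in [set (x + c)%R; (y + c)%R] by rewrite -e !inE eqxx.
have hq : q \in [set (x + c)%R; (y + c)%R] by rewrite -e !inE eqxx orbT.
have npq : p != q.
  apply/negP => /eqP epq; have := subsetP (unfund_diag hP) [set p; q].
  rewrite mem_diagonals2 epq distxx => h; suff : false by []; apply: h.
  by rewrite -{1}epq e; apply/unfundP; exists (x, y), c.
case/set2P: hp npq pqH => ->; case/set2P: hq => ->; rewrite ?eqxx // => _ pqH.
  by exists (x, y), c.
(* The remaining case is a diameter read from its other end. *)
have hN := NH.
(* Both orientations are short only at length H, which forces N = H and the full interval [0, N];
   reversing it amounts to translating it by [N]. *)
have [ex ey] : x = 0 :> nat /\ y = N :> nat /\ N = H.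
  move: h4 h5 pqH; set o : V := 0%R; clearbody o; move: (x + c)%R (y + c)%R => p' q'.
  by clear -h1 h2 h3 hN => h4 h5 pqH; split; [|split]; cyc o.
exists (x, y), (c + N%:R)%R; split=> //.
  have := distD 0%R c (N%:R)%R; rewrite !dist0x valN => -[] [_ h];
    first by rewrite h dvdn_addr.
  have : N %| (c + N%:R)%R + 2 * H by rewrite h dvdn_addr.
  by rewrite dvdn_addl // dvdn_mull.
have xE : x = 0%R by apply/val_inj.
case: ey => ey eN; have yE : y = (N%:R)%R by apply/val_inj; rewrite /= ey valN.
rewrite /rotp xE yE /= !add0r addrC; congr pair.
have -> : (N%:R + (c + N%:R) = c + (N + N)%:R :> V)%R by rewrite natrD addrCA.
rewrite (_ : (N + N)%:R = 0 :> V)%R ?addr0 //; apply/val_inj; rewrite /= val_natV.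
by rewrite eN addnn -mul2n modnn.
Qed.

Lemma unfund_free (P : {set V * V}) : linfam N P -> 0%R \in freepts (unfund P).
Proof.
move=> hP; apply/freeptsP => I /(shorts_unfund hP)[[x y] [c [IP cN ->]]].
have [h1 h2 h3 h4 h5] := unfund_pos hP IP cN; rewrite /ins /=.
move: h4 h5; set o : V := 0%R; clearbody o; move: (x + c)%R (y + c)%R => p' q'.
by clear -h1 h2 h3 => h4 h5; cyc o.
Qed.

Lemma unfundK (P : {set V * V}) : linfam N P -> fund (unfund P) = P.
Proof.
move=> hP; apply/setP => I; rewrite inE; apply/andP/idP => [[]|IP].
  move=> /(shorts_unfund hP)[[x y] [c [IP cN ->]]] lt0.
  have [h1 h2 h3 h4 h5] := unfund_pos hP IP cN.
  have lt : (x + c)%R < N := lt0; rewrite -dist0x h4 in lt.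
  have c0 : c = 0%R.
    apply/val_inj => /=; case: (posnP c) => // c_gt0; have := dvdn_leq c_gt0 cN.
    by clear -lt; lia.
  by rewrite c0 /rotp /= !addr0.
have hN := NH; have N0 : N %| (0%R : V) by [].
case: I IP => x y IP; have [h1 h2 h3 h4 h5] := unfund_pos hP IP N0; rewrite /= in h1 h2 *.
split; last by clear -h1 h2; lia.
rewrite inE /=; apply/andP; split.
  by apply/unfundP; exists (x, y), 0%R; rewrite /= !addr0.
move: h1 h2; rewrite -(dist0x x) -(dist0x y); set o : V := 0%R; clearbody o.
by clear -hN => h1 h2; cyc o.
Qed.

End Period.
End Rotation.

(** * Faces and their fixed points *)

Lemma leq_sumn (s : seq nat) j : j \in s -> j <= sumn s.
Proof.
elim: s => //= i s IH; rewrite inE => /predU1P[->|/IH]; first exact: leq_addr.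
by move=> h; apply: leq_trans h (leq_addl _ _).
Qed.

Lemma all_leq_double (s : seq nat) n : sumn s <= n -> all (fun j => j <= 2 * n) s.
Proof. by move=> le_n; apply/allP => j /leq_sumn; move: le_n; clear; lia. Qed.

Section Faces.
Variables m n : nat.
Hypotheses (m_gt0 : 0 < m) (n_gt0 : 0 < n).
Local Notation V := (vertex m n).
Local Notation H := (halfgon m n).
Implicit Types (x y z u v c g p q o : V) (I J : V * V) (S d e : {set V}) (E F a b :
  {set {set V}})
  (f : {set {set {set V}}}).

Let H_gt1 : 1 < H. Proof. by rewrite /halfgon ltnS muln_gt0 m_gt0. Qed.

Lemma antipodeE d : antipode d = rotd (H%:R)%R d. Proof. by []. Qed.

Lemma natV_full : ((2 * H)%:R = 0 :> V)%R.
Proof. by apply/val_inj; rewrite /= val_natV modnn. Qed.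

Lemma antipodeK : involutive (@antipode m n).
Proof. by move=> d; rewrite !antipodeE rotdD -natrD addnn -mul2n natV_full rotd0. Qed.

Lemma antipode_rot g d : antipode (rotd g d) = rotd g (antipode d).
Proof. by rewrite !antipodeE !rotdD addrC. Qed.

Lemma diagonal_rot g d : d \in diagonals m n -> rotd g d \in diagonals m n.
Proof.
move=> dd; have := @diagonals_rot m n g [set d].
by rewrite /rotE imset_set1 !sub1set; apply.
Qed.

(** Inverse to [cover], between centrally symmetric sets of diagonals and sets of type B
    diagonals. *)
Definition pairs_of E : {set {set {set V}}} := [set [set d; antipode d] | d in E].

Lemma pairs_ofP f a d : f \subset B_diagonals m n -> a \in f -> d \in a ->
  [/\ d \in diagonals m n & a = [set d; antipode d]].
Proof.
move=> /subsetP fB /fB /imsetP[e ed ->] /set2P[] -> //.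
by split; [rewrite antipodeE diagonal_rot | rewrite antipodeK setUC].
Qed.

Lemma cover_diag f : f \subset B_diagonals m n -> cover f \subset diagonals m n.
Proof. by move=> fB; apply/subsetP => d /bigcupP[a af da];
  case: (pairs_ofP fB af da). Qed.

Lemma cover_antipode f : f \subset B_diagonals m n -> periodic (H%:R)%R (cover f).
Proof.
move=> fB; apply/eqP; rewrite eqEcard [X in _ <= X]card_imset ?leqnn ?andbT;
  last exact: can_inj (rotdK _).
apply/subsetP => _ /imsetP[d /bigcupP[a af da] ->]; rewrite -antipodeE.
apply/bigcupP; exists a => //; have [_ ->] := pairs_ofP fB af da.
by rewrite !inE eqxx orbT.
Qed.

Lemma cover_pairsK f : f \subset B_diagonals m n -> pairs_of (cover f) = f.
Proof.
move=> fB; apply/setP => a; apply/imsetP/idP => [[d /bigcupP[b bf db] ->]|af].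
  by have [_ <-] := pairs_ofP fB bf db.
have /imsetP[d dd e] := subsetP fB _ af; exists d => //.
by apply/bigcupP; exists a => //; rewrite e !inE eqxx.
Qed.

Lemma pairs_coverK E : periodic (H%:R : V)%R E -> cover (pairs_of E) = E.
Proof.
move=> pE; apply/setP => d; apply/bigcupP/idP => [[a /imsetP[e eE ->]]|dE].
  by case/set2P => -> //; rewrite antipodeE -pE mem_rotE.
by exists [set d; antipode d]; rewrite ?inE ?eqxx //; apply/imsetP; exists d.
Qed.

Lemma pairs_of_sub E : E \subset diagonals m n -> pairs_of E \subset B_diagonals m n.
Proof. by move=> Ed; apply: imsetS. Qed.

Lemma shorts_sub E F : E \subset F -> shorts E \subset shorts F.
Proof. by move=> /subsetP EF; apply/subsetP => I; rewrite !inE => /andP[/EF -> ->]. Qed.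

Lemma noncrossing_sub E F : E \subset F -> noncrossing F -> noncrossing E.
Proof.
move=> /subsetP EF /forall_inP h; apply/forall_inP => d /EF dF;
  apply/forall_inP => e /EF eF.
by move/forall_inP: (h d dF) => /(_ e eF).
Qed.

(** Noncrossing concerns two diagonals and the length condition one, so both pass between the unions
    [a :|: b] and the whole dissection, unlike a condition on cells. *)
Lemma complexP f : reflect [/\ f \subset B_diagonals m n, noncrossing (cover f) &
    forall I, I \in shorts (cover f) -> m %| (dist I.1 I.2).-1]
  (f \in m_cluster_complex m n).
Proof.
rewrite inE; apply: (iffP andP) => [[fB /forall_inP h]|[fB nc len]]; split=> //.
- apply/forall_inP => d /bigcupP[a af da]; apply/forall_inP => e /bigcupP[b bf eb].
  move/forall_inP: (h a af) => /(_ b bf) /andP[/forall_inP nc _].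
  have := nc d; rewrite in_setU da => /(_ isT) /forall_inP /(_ e).
  by rewrite in_setU eb orbT => /(_ isT).
- move=> I; rewrite inE => /andP[/bigcupP[a af Ia] Is].
  move/forall_inP: (h a af) => /(_ a af); rewrite /B_compatible setUid => /andP[nc].
  have ad : a \subset diagonals m n by apply/subsetP => d da; case: (pairs_ofP fB af da).
  by rewrite (m_divisible_len ad nc H_gt1) => /forall_inP; apply; rewrite inE Ia.
apply/forall_inP => a af; apply/forall_inP => b bf.
have sub : a :|: b \subset cover f.
  by rewrite subUset; apply/andP; split; [apply: (bigcup_sup a)|apply: (bigcup_sup b)].
have nc' := noncrossing_sub sub nc; rewrite /B_compatible nc' /=.
rewrite (m_divisible_len (subset_trans sub (cover_diag fB)) nc' H_gt1).
by apply/forall_inP => I IE; apply: len; apply: (subsetP (shorts_sub sub)).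
Qed.

Lemma rotationE f g : rotation m n f g = [set rotE g a | a in f].
Proof. by []. Qed.

Lemma cover_rotation f g : cover (rotation m n f g) = rotE g (cover f).
Proof.
rewrite rotationE; apply/setP => d; apply/bigcupP/imsetP.
  move=> [_ /imsetP[a af ->] /imsetP[e ea ->]]; exists e => //.
  by apply/bigcupP; exists a.
move=> [e /bigcupP[a af ea] ->]; exists (rotE g a); first by apply: imset_f.
exact: imset_f.
Qed.

Lemma B_rotation f g : f \subset B_diagonals m n ->
  rotation m n f g \subset B_diagonals m n.
Proof.
move=> /subsetP fB; rewrite rotationE;
  apply/subsetP => _ /imsetP[a /fB /imsetP[d dd ->] ->].
by apply/imsetP; exists (rotd g d);
  rewrite ?diagonal_rot // /rotE imsetU1 imset_set1 antipode_rot.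
Qed.

Lemma parabolic_typeP f (lam : seq nat) : is_partition lam ->
  all (fun j => j <= 2 * n) lam ->
  reflect (forall j, 0 < j <= 2 * n -> (dissection_mult f j)./2 = count_mem j lam)
    (parabolic_type f == lam).
Proof.
move=> /andP[slam lam0] /allP lamn; rewrite /parabolic_type.
have cnt (h : nat -> nat) s j : uniq s ->
    count_mem j (flatten [seq nseq (h i) i | i <- s]) = if j \in s then h j else 0.
  elim: s => //= i s IH /andP[nis us]; rewrite count_cat IH // count_nseq inE.
  case: (eqVneq j i) => [->|ne]; first by rewrite (negbTE nis) mem_head mul1n addn0.
  by rewrite inE (negbTE ne).
have srt (h : nat -> nat) k l : pairwise leq (flatten [seq nseq (h i) i | i <- iota k
  l]) /\
    all (leq k) (flatten [seq nseq (h i) i | i <- iota k l]).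
  elim: l k => //= l IH k; have [IH1 IH2] := IH k.+1.
  have IH3 : all (leq k) (flatten [seq nseq (h i) i | i <- iota k.+1 l]).
    by apply: sub_all IH2 => i /ltnW.
  rewrite pairwise_cat all_cat IH1 IH3 !andbT; split; last by rewrite all_nseq leqnn orbT.
  apply/andP; split; first by apply/allrelP => i j;
    rewrite mem_nseq => /andP[_ /eqP ->] /(allP IH3).
  by elim: (h k) => //= r ->; rewrite andbT all_nseq leqnn orbT.
apply: (iffP eqP) => [<- j jn|h].
  by rewrite (cnt (fun j =>
    (dissection_mult f j)./2)) ?iota_uniq // mem_iota add1n ltnS jn.
apply: (sorted_eq leq_trans anti_leq) => //.
  by rewrite sorted_pairwise;
    [case: (srt (fun j => (dissection_mult f j)./2) 1 (2 * n)) | exact: leq_trans].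
apply/allP => j _ /=; apply/eqP.
rewrite (cnt (fun j => (dissection_mult f j)./2)) ?iota_uniq // mem_iota add1n ltnS.
case: ifP => [/h //|jn]; symmetry; apply/count_memPn; apply/negP => jl.
have := lamn _ jl; case: j jl jn => [l0|j _]; first by rewrite l0 in lam0.
by move=> /= ->.
Qed.

Definition arc_mult E w := #|[set I in shorts E | arcwt E I == w]|.

(** Central symmetry is periodicity with period H, whose fundamental domain occurs twice. *)
Lemma arc_mult_even E w : periodic (H%:R : V)%R E -> arc_mult E w = (arc_mult E w)./2.*2.
Proof.
move=> pE; have H0 : 0 < H by [].
rewrite /arc_mult (card_periodic H0 (dvdnn H) w pE) mulnK // mul2n doubleK.
by [].
Qed.

(** A multiplicity a_j is an even number of arcs, plus 1 if the central cell has that size; the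
    halving removes this 1 and leaves a condition on arcs alone. *)
Lemma facesP f (lam : seq nat) : is_partition lam -> all (fun j => j <= 2 * n) lam ->
  reflect [/\ f \subset B_diagonals m n, noncrossing (cover f),
      (forall I, I \in shorts (cover f) -> m %| arcwt (cover f) I) &
      forall j, 0 < j <= 2 * n -> arc_mult (cover f) (m * j) = (count_mem j lam).*2]
    (f \in faces_of_type m n lam).
Proof.
move=> lamP lamn.
have key : f \subset B_diagonals m n -> noncrossing (cover f) -> forall j, 0 < j ->
    (dissection_mult f j)./2.*2 = arc_mult (cover f) (m * j).
  move=> fB nc j j0; rewrite /dissection_mult (card_cells (cover_diag fB) nc H_gt1);
    last by rewrite muln_gt0 m_gt0.
  rewrite -/(arc_mult _ _); have := arc_mult_even (m * j) (cover_antipode fB).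
  move: (_ == _) (arc_mult _ _)./2 => e k ->.
  by case: e; rewrite ?addn1 ?addn0 /= ?uphalf_double ?doubleK.
have dvdE : f \subset B_diagonals m n -> noncrossing (cover f) ->
    (forall I, I \in shorts (cover f) -> m %| (dist I.1 I.2).-1) <->
    (forall I, I \in shorts (cover f) -> m %| arcwt (cover f) I).
  move=> fB nc; have := m_divisible_len (cover_diag fB) nc H_gt1.
  rewrite (m_divisible_wt (cover_diag fB) nc H_gt1) => e.
  split=> h; apply/forall_inP; first by rewrite e; apply/forall_inP.
  by rewrite -e; apply/forall_inP.
rewrite inE; apply: (iffP andP) => [[/complexP[fB nc len] ty]|[fB nc wt mu]].
  split=> //; first by apply/dvdE.
  move=> j jn; move/(parabolic_typeP _ lamP lamn): ty => /(_ j jn) <-; rewrite key //.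
  by case/andP: jn.
split; first by apply/complexP; split=> //; apply/dvdE.
apply/(parabolic_typeP _ lamP lamn) => j jn; apply: double_inj; rewrite key ?mu //.
by case/andP: jn.
Qed.

Lemma faces_rotation f g (lam : seq nat) : is_partition lam ->
  all (fun j => j <= 2 * n) lam ->
  f \in faces_of_type m n lam -> rotation m n f g \in faces_of_type m n lam.
Proof.
move=> lamP lamn /(facesP _ lamP lamn)[fB nc wt mu]; apply/facesP => //.
rewrite cover_rotation; split=> //.
- exact: B_rotation.
- exact: noncrossing_rot (cover_diag fB) nc.
- move=> I; rewrite -(rotpNK g I) shorts_rot arcwt_rot; exact: wt.
- by move=> j jn; rewrite /arc_mult card_arcwt_rot; apply: mu.
Qed.

Lemma arcwt_le E I : E \subset diagonals m n -> noncrossing E -> I \in shorts E ->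
  arcwt E I <= m * (2 * n).
Proof.
move=> Ed nc IE; have := card_ucell Ed nc IE; have := max_card (mem (ucell E I)).
by rewrite card_ord => + e; rewrite e !ltnS mulnCA mulnA.
Qed.

Lemma sum_arcwt_mult E : E \subset diagonals m n -> noncrossing E ->
    (forall I, I \in shorts E -> m %| arcwt E I) ->
  \sum_(I in shorts E) arcwt E I = \sum_(1 <= j < (2 * n).+1) m * j * arc_mult E (m * j).
Proof.
move=> Ed nc wt.
rewrite (eq_bigr (fun j => \sum_(I in shorts E | arcwt E I == m * j) arcwt E I));
  last first.
  move=> j _; rewrite (eq_bigr (fun => m * j)); last by move=> I /andP[_ /eqP].
  rewrite sum_nat_const mulnC; congr (_ * _); apply: eq_card => I.
  by rewrite in_set.
rewrite (exchange_big_dep (mem (shorts E))) /=; last by move=> i I _ /andP[].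
apply: eq_bigr => I IE; have /dvdnP[j e] := wt I IE.
rewrite IE /= big_mkcond /= (bigD1_seq j) ?iota_uniq //=; last first.
  have := arcwt_le Ed nc IE; have := arcwt_gt0 Ed nc IE.
  by rewrite e mulnC leq_pmul2l // muln_gt0 m_gt0 /= mem_index_iota ltnS => -> ->.
rewrite e mulnC eqxx big1 ?addn0 // => i nij.
by rewrite eqn_pmul2l // eq_sym (negbTE nij).
Qed.

Lemma sumn_count (lam : seq nat) K : is_partition lam -> all (fun j => j <= K) lam ->
  sumn lam = \sum_(1 <= j < K.+1) j * count_mem j lam.
Proof.
move=> /andP[_ lam0] /allP lamK; rewrite sumnE.
transitivity (\sum_(i <- lam) \sum_(1 <= j < K.+1) (if i == j then j else 0)).
  apply: eq_big_seq => i il; rewrite (bigD1_seq i) ?iota_uniq //=.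
    by rewrite eqxx big1 ?addn0 // => j; rewrite eq_sym => /negbTE ->.
  rewrite mem_index_iota ltnS lamK // andbT lt0n; apply: contraNneq lam0 => <- //.
rewrite exchange_big; apply: eq_bigr => j _ /=.
rewrite -big_mkcond /= big_const_seq iter_addn_0; congr (_ * _).
Qed.

Lemma card_freepts f (lam : seq nat) : is_partition lam ->
  all (fun j => j <= 2 * n) lam ->
  f \in faces_of_type m n lam ->
  #|freepts (cover f)| + 2 * (m * sumn lam) = 2 * H.
Proof.
move=> lamP lamn /(facesP _ lamP lamn)[fB nc wt mu].
rewrite -(sum_arcwt (cover_diag fB) nc); congr (_ + _).
rewrite (sum_arcwt_mult (cover_diag fB) nc wt) (sumn_count lamP lamn) !big_distrr /=.
apply: eq_big_nat => j jn; rewrite mu // -mul2n; move: (count_mem j lam) => k.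
by rewrite -mulnA [j * (2 * k)]mulnCA mulnCA.
Qed.

(** * Counting the fixed faces *)

Section FixedFaces.
Variables (lam : seq nat) (g : V).
Hypotheses (lam_part : is_partition lam) (lam_le : sumn lam <= n).

Local Notation N := (gcdn g H).
Local Notation e := (H %/ N).
Local Notation X := ('Fix_(faces_of_type m n lam | rotation m n)[g])%g.

Let H_gt0 : 0 < H. Proof. by []. Qed.
Let N_gt0 : 0 < N. Proof. by rewrite gcdn_gt0 H_gt0 orbT. Qed.
Let N_dvd : N %| H. Proof. exact: dvdn_gcdr. Qed.
Let eN : e * N = H. Proof. exact: divnK. Qed.
Let e_gt0 : 0 < e. Proof. by rewrite divn_gt0 // dvdn_leq. Qed.
Let De : 2 * H %/ N = 2 * e. Proof. by rewrite muln_divA. Qed.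

Let lam_le2 : all (fun j => j <= 2 * n) lam. Proof. exact: all_leq_double. Qed.

Lemma count_gt j : 2 * n < j -> count_mem j lam = 0.
Proof.
move=> jn; apply/count_memPn; apply/negP => /(allP lam_le2); rewrite leqNgt jn //.
Qed.

Lemma periodic_gcd E : periodic g E -> periodic (H%:R : V)%R E -> periodic (N%:R : V)%R E.
Proof.
move=> pg pH; have [km kn kE _] := egcdnP g H_gt0.
have e1 : (((H%:R : V) *+ km) = g *+ kn + N%:R :> V)%R.
  have {}kE : H * km = g * kn + N by rewrite (mulnC H) kE (mulnC g) (gcdnC g).
  by rewrite -mulrnA kE natrD mulrnA natVK.
have p1 := periodicMn km pH; have p2 := periodicMn kn pg.
rewrite e1 /periodic -rotED p2 in p1; exact: p1.
Qed.

Lemma fixedP f : reflect [/\ f \subset B_diagonals m n, noncrossing (cover f),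
      (forall I, I \in shorts (cover f) -> m %| arcwt (cover f) I),
      forall j, 0 < j <= 2 * n -> arc_mult (cover f) (m * j) = (count_mem j lam).*2 &
      periodic (N%:R : V)%R (cover f)]
    (f \in X).
Proof.
apply: (iffP setIP) => [[/(facesP _ lam_part lam_le2)[fB nc wt mu] /afix1P fx]|[fB nc
  wt mu pN]].
  split=> //; apply: periodic_gcd (cover_antipode fB).
  by rewrite /periodic -cover_rotation fx.
split; first exact/facesP.
apply/afix1P; rewrite -[RHS](cover_pairsK fB) -(cover_pairsK (B_rotation g fB));
  congr pairs_of.
by rewrite cover_rotation; apply: periodic_dvd pN (dvdn_gcdl _ _).
Qed.

(** The fixed faces that can be cut at vertex 0. *)
Definition fixed0 := [set f in X | 0%R \in freepts (cover f)].

Lemma fixed_rotation f x : (rotation m n f x \in X) = (f \in X).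
Proof.
suff key h y : h \in X -> rotation m n h y \in X.
  apply/idP/idP => [/(key _ (x^-1)%g)|/key //].
  by rewrite actK.
case/setIP => hf /afix1P hx; apply/setIP; split; first exact: faces_rotation.
apply/afix1P; rewrite -actM.
have -> : (y * g = g * y)%g by apply: addrC.
by rewrite actM hx.
Qed.

(** Every vertex is free in equally many fixed faces: the rotation group is commutative, hence acts
    on the fixed faces, and it is transitive on vertices. *)
Lemma fixed_double_count : #|X| * (2 * (H - m * sumn lam)) = 2 * H * #|fixed0|.
Proof.
have <- : \sum_(f in X) #|freepts (cover f)| = #|X| * (2 * (H - m * sumn lam)).
  rewrite -sum_nat_const; apply: eq_bigr => f /setIP[fX _].
  have := card_freepts lam_part lam_le2 fX; move: #|_| => A; clear; lia.
under eq_bigr do rewrite -sum1_card big_mkcond.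
have cV : 2 * H = #|{: V}| by rewrite card_ord cardV.
rewrite exchange_big /= cV -sum_nat_const.
apply: eq_bigr => x _; rewrite -big_mkcondr sum1_card.
rewrite -[RHS](card_imset _ (act_inj (rotation m n) x)); apply: eq_card => f.
rewrite unfold_in; apply/andP/imsetP => [[fX xf]|[h]].
  exists (rotation m n f (x^-1)%g); last by rewrite actKV.
  rewrite inE fixed_rotation fX /= cover_rotation.
  have -> : (0 = x + x^-1%g :> V)%R by rewrite subrr.
  by rewrite freepts_rot.
rewrite inE => /andP[hX h0] ->; rewrite fixed_rotation hX cover_rotation.
by rewrite -[x in x \in freepts _]add0r freepts_rot.
Qed.

(** For a part j of multiplicity n_j there are 2 n_j arcs of weight m j, of which one in 2e starts
    in the fundamental domain. *)
Definition orbit_mult w := if m %| w then count_mem (w %/ m) lam %/ e else 0.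

Lemma mult_fund E w : E \subset diagonals m n -> noncrossing E ->
    periodic (N%:R : V)%R E -> 0%R \in freepts E ->
  e * mult (fund N E) w = (arc_mult E w)./2.
Proof.
move=> Ed nc pN f0; rewrite /arc_mult (card_periodic N_gt0 N_dvd w pN) De.
rewrite -(mulnA 2 e) (mul2n (e * _)) doubleK; congr (_ * _); apply: eq_card => I.
rewrite in_set [RHS]in_set; case IE: (I \in fund N E) => //=.
by rewrite weight_fund.
Qed.

Lemma linfams_fund f : f \in fixed0 ->
  fund N (cover f) \in linfams (2 * m * n).+2 N orbit_mult.
Proof.
rewrite inE => /andP[/fixedP[fB nc wt mu pN] f0]; have Ed := cover_diag fB.
apply/linfamsP; split; first exact: linfam_fund.
move=> w wK; have := mult_fund w Ed nc pN f0; rewrite /orbit_mult.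
have fac0 : (forall I, I \in shorts (cover f) -> arcwt (cover f) I != w) ->
    e * mult (fund N (cover f)) w = (arc_mult (cover f) w)./2 ->
      mult (fund N (cover f)) w = 0.
  move=> no; rewrite /arc_mult (_ : [set I in _ | _] = set0) ?cards0; last first.
    by apply/setP => I; rewrite in_set in_set0; apply/negP => /andP[/no /negbTE ->].
  by move/eqP; rewrite muln_eq0 eqn0Ngt e_gt0 => /eqP.
case: ifP => [/dvdnP[j wj]|nd]; last first.
  by apply: fac0 => I /wt; apply: contraTneq => ->; rewrite nd.
rewrite wj mulnK // -wj; case: (posnP j) => [j0|j0].
  rewrite (_ : count_mem j lam = 0) ?div0n; last first.
    by rewrite j0; apply/count_memPn; case/andP: lam_part.
  apply: fac0 => I IE; have := arcwt_gt0 Ed nc IE; rewrite wj j0 mul0n.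
  by case: (arcwt _ _).
case: (leqP j (2 * n)) => jn; last first.
  rewrite count_gt // div0n; apply: fac0 => I IE; have := arcwt_le Ed nc IE.
  by rewrite wj => h; apply/eqP => h'; move: h; rewrite h' mulnC leq_pmul2l // leqNgt jn.
rewrite wj [j * m]mulnC mu ?j0 // doubleK => <-.
by rewrite (mulKn _ e_gt0).
Qed.

Lemma fixed0_dvd f j : f \in fixed0 -> e %| count_mem j lam.
Proof.
rewrite inE => /andP[/fixedP[fB nc wt mu pN] f0]; have Ed := cover_diag fB.
case: (posnP j) => [->|j0].
  by rewrite (_ : count_mem 0 lam = 0) ?dvdn0 //; apply/count_memPn; case/andP: lam_part.
case: (leqP j (2 * n)) => jn; last by rewrite count_gt.
have := mult_fund (m * j) Ed nc pN f0; rewrite mu ?j0 // doubleK => <-.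
exact: dvdn_mulr.
Qed.

(** The inverse repeats a family along the multiples of [N] and pairs antipodal diagonals.
    Divisibility ensures that the repeated multiplicities are those of [lam] rather than rounded
    ones. *)
Lemma card_fixed0 : (forall j, e %| count_mem j lam) ->
  #|fixed0| = #|linfams (2 * m * n).+2 N orbit_mult|.
Proof.
move=> dv; pose F f := fund N (cover f).
have <- : F @: fixed0 = linfams (2 * m * n).+2 N orbit_mult; last first.
  rewrite card_in_imset // => f h;
    rewrite ![_ \in fixed0]in_set => /andP[/fixedP[fB fnc _ _ fN] _].
  move=> /andP[/fixedP[hB hnc _ _ hN] _] eF.
  rewrite -(cover_pairsK fB) -(cover_pairsK hB); congr pairs_of.
  rewrite -(fundK N_gt0 (cover_diag fB) fnc fN).
  by rewrite -(fundK N_gt0 (cover_diag hB) hnc hN) -/(F f) eF.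
apply/setP => P; apply/imsetP/idP => [[f fX ->]|]; first exact: linfams_fund.
case/linfamsP => hP hm.
pose E : {set {set V}} := unfund N P.
have Ed : E \subset diagonals m n by apply: unfund_diag.
have nc : noncrossing E by apply: unfund_nc.
have pN : periodic (N%:R : V)%R E by apply: unfund_periodic.
have f0 : 0%R \in freepts E by apply: unfund_free.
have fE : fund N E = P by apply: unfundK.
have pH : periodic (H%:R : V)%R E.
  by rewrite -eN (mulnC e N) mulrnA; apply: periodicMn.
have cE : cover (pairs_of E) = E by apply: pairs_coverK.
have facE w : w < (2 * m * n).+2 -> arc_mult E w = (e * orbit_mult w).*2.
  move=> wK; have := mult_fund w Ed nc pN f0; rewrite fE hm // => ->.
  exact: arc_mult_even.
exists (pairs_of E); last by rewrite /F cE fE.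
rewrite inE cE f0 andbT; apply/fixedP; rewrite cE; split=> //.
- exact: pairs_of_sub.
- move=> I IE; apply: contraT => nd.
  have wK : arcwt E I < (2 * m * n).+2.
    by have := arcwt_le Ed nc IE; rewrite mulnA [m * 2]mulnC => h;
      apply: leq_trans h _; rewrite leqnSn.
  have := facE _ wK; rewrite /orbit_mult (negbTE nd) muln0 => /eqP.
  by rewrite cards_eq0 => /eqP/setP/(_ I); rewrite in_set in_set0 IE eqxx.
- move=> j /andP[j0 jn]; rewrite facE; last first.
    by rewrite ltnW // ltnS ltnS [2 * m]mulnC -mulnA leq_mul2l jn orbT.
  rewrite /orbit_mult dvdn_mulr // mulKn //; congr _.*2.
  by rewrite (mulnC e) divnK.
Qed.

Local Notation B := (\max_(i <- lam) i).

Let B_le : B <= n.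
Proof.
by apply/bigmax_leqP_seq => j jl _; apply: leq_trans lam_le; apply: leq_sumn.
Qed.

(** [orbit_mult] is supported on the weights m j with j a part. The law is arbitrary because both
    sums and a product of factorials are reindexed. *)
Lemma big_orbit_mult (T : Type) (idx : T) (op : Monoid.com_law idx) (G : nat -> T) :
    (forall w, orbit_mult w = 0 -> G w = idx) ->
  \big[op/idx]_(w < (2 * m * n).+2) G w = \big[op/idx]_(1 <= j < B.+1) G (m * j).
Proof.
move=> G0; pose s := [seq m * j | j <- index_iota 1 B.+1].
rewrite -(big_mkord xpredT G) (bigID (fun w => w \in s)) /= [X in op _ X]big1_seq;
  last first.
  move=> w /andP[ws _]; apply: G0; rewrite /orbit_mult; case: ifP => // /dvdnP[j wj].
  rewrite wj mulnK // (_ : count_mem j lam = 0) ?div0n //; apply/count_memPn.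
  apply: contra ws => jl; rewrite wj mulnC; apply: map_f.
  rewrite mem_index_iota ltnS (leq_bigmax_seq _ jl) // andbT lt0n.
  by case/andP: lam_part => _; apply: contraNneq => <-.
rewrite Monoid.mulm1 -big_filter (perm_big s) ?big_map //.
have us : uniq s by rewrite map_inj_uniq ?iota_uniq // => i j /eqP;
  rewrite eqn_pmul2l // => /eqP.
apply: uniq_perm; rewrite ?filter_uniq ?iota_uniq // => w; rewrite mem_filter.
case ws: (w \in s) => //=; case/mapP: ws => j; rewrite mem_index_iota => /andP[_ jB] ->.
rewrite mem_index_iota /= ltnW // !ltnS [2 * m]mulnC -mulnA leq_mul2l; apply/orP; right.
by move: jB B_le; clear; lia.
Qed.

Lemma count_mem0 : count_mem 0 lam = 0.
Proof. by apply/count_memPn; case/andP: lam_part. Qed.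

Theorem card_fixed : (forall j, e %| count_mem j lam) ->
  #|X| * (N.-1`! * \prod_(1 <= j < B.+1) (count_mem j lam %/ e)`!) =
  (N + size lam %/ e).-1`!.
Proof.
move=> dv; have orbE j : orbit_mult (m * j) = count_mem j lam %/ e.
  by rewrite /orbit_mult dvdn_mulr // mulKn.
have le_B : all (fun j => j <= B) lam by apply/allP => j jl; apply: leq_bigmax_seq.
set s := \sum_(w < (2 * m * n).+2) w * orbit_mult w.
have sE : e * s = m * sumn lam.
  rewrite /s (@big_orbit_mult _ _ _ (fun w => w * orbit_mult w));
    last by move=> w ->; rewrite muln0.
  rewrite (sumn_count lam_part le_B) !big_distrr; apply: eq_bigr => j _ /=.
  rewrite orbE; have /esym -> := divnK (dv j).
  by move: (count_mem j lam %/ e) => k; rewrite mulnK //; move: (H %/ _) => a; lia.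
have LE : \sum_(w < (2 * m * n).+2) orbit_mult w = size lam %/ e.
  rewrite (@big_orbit_mult _ _ _ orbit_mult) // (size_count_mem lam_part).
  rewrite [in RHS](eq_bigr (fun j => e * orbit_mult (m * j))); last first.
    by move=> j _; rewrite orbE (mulnC e) (divnK (dv j)).
  by rewrite -big_distrr /= mulKn.
(* The factor N - s gets cancelled below; it is positive because m|lam| <= mn < H. *)
have sN : s < N.
  rewrite -(ltn_pmul2l e_gt0) sE eN /halfgon ltnS leq_mul2l lam_le orbT //.
have NK : N < (2 * m * n).+2.
  by apply: leq_ltn_trans (dvdn_leq H_gt0 N_dvd) _; rewrite cardV ltn_Pmull.
have c0 : orbit_mult 0 = 0 by rewrite /orbit_mult dvdn0 div0n count_mem0 div0n.
have := card_linfams N_gt0 NK c0 (ltnW sN); rewrite -/s LE.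
rewrite (@big_orbit_mult _ _ _ (fun w => (orbit_mult w)`!)); last by move=> w ->.
under [X in _ * (_ * X)]eq_bigr do rewrite orbE.
move: (\prod_(1 <= j < B.+1) _) => Pi; rewrite -(card_fixed0 dv).
have : #|X| * (2 * (e * N - e * s)) = 2 * (e * N) * #|fixed0|.
  by rewrite eN sE; apply: fixed_double_count.
move: #|X| #|fixed0| => A F; rewrite -mulnBr => h1 h2.
(* The double count divided by 2e; combined with [card_linfams] it lets N - s cancel. *)
have {}h1 : A * (N - s) = N * F.
  apply/eqP; rewrite -(eqn_pmul2l (_ : 0 < 2 * e)) ?muln_gt0 ?e_gt0 //; apply/eqP.
  by move: h1; move: (N - s) => k; move: (H %/ _) => a; lia.
have fN : N`! = N * (N.-1)`! by rewrite -{1}(prednK N_gt0) factS prednK.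
apply/eqP; rewrite -(eqn_pmul2l (_ : 0 < N - s)) ?subn_gt0 // -(eqn_pmul2l N_gt0);
  apply/eqP.
rewrite -[in RHS]h2 fN; move: h1; move: (N - s) => k; move: (N.-1)`! => a;
  move: N => b h1.
rewrite [RHS](_ : _ = b * F * (b * a * Pi)); last by lia.
by rewrite -h1; lia.
Qed.

(** No fixed face can be cut at 0, and every face has H - m|lam| > 0 antipodal pairs of free
    vertices; so the double count leaves no fixed face. *)
Theorem card_fixed_eq0 j : ~~ (e %| count_mem j lam) -> #|X| = 0.
Proof.
move=> nd; have f0 : #|fixed0| = 0.
  by apply/eqP; rewrite cards_eq0; apply/set0Pn => -[f /(fixed0_dvd j)];
    rewrite (negbTE nd).
have := fixed_double_count; rewrite f0 muln0 => /eqP; rewrite !muln_eq0 subn_eq0 leqNgt.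
rewrite (_ : m * sumn lam < H) ?orbF; first by move/eqP.
by rewrite /halfgon ltnS leq_mul2l lam_le orbT.
Qed.

End FixedFaces.
End Faces.

(** * Evaluation at roots of unity *)

Import Order.TTheory Num.Theory.
Local Open Scope ring_scope.

(** The q-integer of [a] with q replaced by q^c. *)
Definition qintX (c a : nat) : {poly int} := \sum_(i < a) 'X^(c * i).

Lemma qintX_add c a b : qintX c (a + b) = qintX c a + 'X^(c * a) * qintX c b.
Proof.
rewrite /qintX big_split_ord /=; congr (_ + _).
by rewrite mulr_sumr; apply: eq_bigr => i _; rewrite mulnDr exprD.
Qed.

Lemma qintX_mul c a b : qintX c (a * b) = qintX c a * qintX (c * a) b.
Proof.
elim: b => [|b IH]; first by rewrite muln0 /qintX !big_ord0 mulr0.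
rewrite mulnSr qintX_add IH -[b.+1]addn1 qintX_add mulrDr; congr (_ + _).
by rewrite mulrC mulnA {3}/qintX big_ord1 muln0 expr0 mulr1.
Qed.

Lemma qint_qintX a : qint a = qintX 1 a.
Proof. by apply: eq_bigr => i _; rewrite mul1n. Qed.

Lemma qintX_neq0 c a : (0 < a)%N -> qintX c a != 0.
Proof.
move=> a0; apply/eqP => /(congr1 (fun p => p.[1])); rewrite hornerC horner_sum.
rewrite (eq_bigr (fun => 1)); last by move=> i _; rewrite hornerXn expr1n.
by rewrite sumr_const card_ord => /eqP; rewrite pnatr_eq0 eqn0Ngt a0.
Qed.

(** Counts the factors [e]_(q^2) in a product of consecutive [2i]_q. *)
Lemma sum_dvdn e M0 l : (0 < e)%N ->
  (\sum_(1 <= i < l.+1) (e %| M0 + i) = (M0 + l) %/ e - M0 %/ e)%N.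
Proof.
move=> e0; apply/eqP; rewrite -(eqn_add2r (M0 %/ e)) subnK ?leq_div2r ?leq_addr //.
elim: l => [|l /eqP IH]; first by rewrite big_geq // addn0.
by rewrite big_nat_recr //= addnAC IH !addnS divnS // addnC.
Qed.

Section RootEval.
Variables (F : numFieldType) (z : F) (e : nat).
Hypotheses (e_gt0 : (0 < e)%N) (zX : forall k, (z ^+ (2 * k) == 1) = (e %| k)%N).

Definition qeval (p : {poly int}) : F := (map_poly intr p).[z].

Let qevalM p q : qeval (p * q) = qeval p * qeval q.
Proof. by rewrite /qeval rmorphM hornerM. Qed.

Let qevalD p q : qeval (p + q) = qeval p + qeval q.
Proof. by rewrite /qeval rmorphD hornerD. Qed.

Let qeval_prod (I : Type) (r : seq I) P (G : I -> {poly int}) :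
  qeval (\prod_(i <- r | P i) G i) = \prod_(i <- r | P i) qeval (G i).
Proof. by rewrite /qeval rmorph_prod horner_prod. Qed.

Let qevalXn k : qeval 'X^k = z ^+ k.
Proof. by rewrite /qeval rmorphXn /= map_polyX hornerXn. Qed.

Lemma qeval_qintX c a : qeval (qintX c a) = \sum_(i < a) z ^+ (c * i).
Proof.
by rewrite /qeval rmorph_sum horner_sum; apply: eq_bigr => i _; rewrite -qevalXn.
Qed.

(* [2s]_q divided by [2]_q and, if e divides s, also by [e]_(q^2), which
   vanishes at z when e > 1. *)
Definition rqint s : {poly int} :=
  if (e %| s)%N then qintX (2 * e) (s %/ e) else qintX 2 s.

Lemma qint_double s : qint (2 * s) = qintX 1 2 * qintX 2 e ^+ (e %| s)%N * rqint s.
Proof.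
rewrite qint_qintX qintX_mul /rqint -mulrA; congr (_ * _).
rewrite mul1n; case: ifP => [es|_]; last by rewrite expr0 mul1r.
by rewrite expr1 -{1}(divnK es) mulnC qintX_mul.
Qed.

Definition rho s := qeval (rqint s).

Let z2e : z ^+ (2 * e) = 1. Proof. by apply/eqP; rewrite zX. Qed.

Lemma rho_dvd t : rho (e * t) = t%:R.
Proof.
rewrite /rho /rqint dvdn_mulr // mulKn // qeval_qintX.
rewrite (eq_bigr (fun => 1)); last by move=> i _; rewrite exprM z2e expr1n.
by rewrite sumr_const card_ord.
Qed.

Lemma geomE s : (z ^+ 2 - 1) * qeval (qintX 2 s) = z ^+ (2 * s) - 1.
Proof.
by rewrite exprM [RHS]subrX1 qeval_qintX; congr (_ * _); apply: eq_bigr => i _;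
  rewrite exprM.
Qed.

Lemma rho_neq0 s : (0 < s)%N -> rho s != 0.
Proof.
move=> s0; case: (boolP (e %| s)%N) => [/dvdnP[t st]|nd].
  by rewrite st mulnC rho_dvd pnatr_eq0; apply: contraTneq s0 => t0; rewrite st t0.
rewrite /rho /rqint (negbTE nd); apply/eqP => h; have := geomE s;
  rewrite h mulr0 => /esym/eqP.
by rewrite subr_eq0 zX (negbTE nd).
Qed.

Lemma qeval_qintXe : (1 < e)%N -> qeval (qintX 2 e) = 0.
Proof.
move=> e1; have := geomE e; rewrite z2e subrr => /eqP; rewrite mulf_eq0 subr_eq0.
have := zX 1; rewrite muln1 => ->; rewrite dvdn1 gtn_eqF // => /eqP //.
Qed.

(** Full blocks of [e] consecutive powers of [z ^+ 2] sum to zero. *)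
Lemma rho_add t k : (0 < k < e)%N -> rho (e * t + k) = rho k.
Proof.
move=> /andP[k0 ke].
have nk : (e %| k)%N = false by rewrite gtnNdvd.
have e1 : (1 < e)%N by apply: leq_ltn_trans ke.
rewrite /rho /rqint dvdn_addr ?dvdn_mulr // nk qintX_add qevalD.
rewrite qintX_mul qevalM qeval_qintXe // mul0r add0r qevalM qevalXn.
by rewrite mulnA exprM z2e expr1n mul1r.
Qed.

(** The contribution of the integers strictly between two consecutive multiples of [e]. *)
Let Bl := \prod_(1 <= s < e) rho s.

Lemma Bl_neq0 : Bl != 0.
Proof.
rewrite /Bl big_nat prodf_seq_neq0; apply/allP => s _; apply/implyP => /andP[s0 _].
exact: rho_neq0.
Qed.

Lemma prod_rho_block t : \prod_((e * t).+1 <= s < e * t + e) rho s = Bl.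
Proof.
rewrite -addn1 addnC [(_ + e)%N]addnC big_addn addnK /Bl;
  apply: eq_big_nat => s /andP[s0 se].
by rewrite addnC rho_add // s0.
Qed.

Lemma prod_rho c : \prod_(1 <= s < (e * c).+1) rho s = Bl ^+ c * (c`!)%:R.
Proof.
elim: c => [|c IH]; first by rewrite muln0 big_geq // mul1r.
rewrite mulnS addnC (big_cat_nat (n := (e * c).+1)) //= ?ltnS ?leq_addr // IH.
rewrite big_nat_recr /=; last by rewrite -addn1 leq_add2l.
rewrite prod_rho_block -mulnSr rho_dvd factS natrM exprSr.
by rewrite -!mulrA; congr (_ * _); rewrite mulrCA; congr (_ * _); rewrite mulrC.
Qed.

(** The numerator of [mu] has this form with t = N, as its first index mn + 1 is eN. *)
Lemma prod_rho_shift t L :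
  \prod_(e * t <= s < e * t + e * L) rho s = Bl ^+ L * \prod_(0 <= a < L) (t + a)%:R.
Proof.
elim: L => [|L IH]; first by rewrite muln0 addn0 !big_geq // mulr1.
rewrite mulnSr addnA (big_cat_nat (n := (e * t + e * L)%N)) //= ?leq_addr // IH.
rewrite [X in _ * X]big_ltn; last by rewrite -{1}[(e * t + e * L)%N]addn0 ltn_add2l.
rewrite -mulnDr prod_rho_block rho_dvd [in RHS]big_nat_recr //= exprSr.
by rewrite -!mulrA; congr (_ * _); rewrite [RHS]mulrCA; congr (_ * _); rewrite mulrC.
Qed.

Variables (m n N : nat) (lam : seq nat).
Hypotheses (lam_part : is_partition lam) (eN : (e * N = (m * n).+1)%N).
Local Notation B := (\max_(i <- lam) i)%N.
Local Notation c j := (count_mem j lam).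

Let N_gt0 : (0 < N)%N. Proof. by case: N eN => //; rewrite muln0. Qed.

(** The powers of [e]_(q^2) are isolated at the level of polynomials, since they vanish at [z] when
    e > 1 and must be cancelled before evaluation. The factors [2]_q cancel because there are l of
    them on either side. *)
Lemma mu_reduced :
  mu m n lam * qintX 2 e ^+ (\sum_(1 <= j < B.+1) c j %/ e)%N *
    (\prod_(1 <= j < B.+1) \prod_(1 <= s < (c j).+1) rqint s) =
  qintX 2 e ^+ ((m * n + size lam) %/ e - (m * n) %/ e)%N *
    \prod_(1 <= i < (size lam).+1) rqint (m * n + i).
Proof.
have := mu_denK m n lam_part; rewrite /mu_num /mu_den.
have den j : \prod_(1 <= s < (c j).+1) qint (2 * s) =
   qintX 1 2 ^+ c j * qintX 2 e ^+ (c j %/ e)%N * \prod_(1 <= s < (c j).+1) rqint s.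
  rewrite (eq_bigr _ (fun s _ => qint_double s)) !big_split /=; congr (_ * _ * _).
    by rewrite prodr_const_nat subn1.
  by rewrite -expr_sum; congr (_ ^+ _); have := sum_dvdn 0 (c j) e_gt0;
    rewrite div0n subn0.
have num : \prod_(1 <= i < (size lam).+1) qint (2 * m * n + 2 * i) =
   qintX 1 2 ^+ size lam * qintX 2 e ^+ ((m * n + size lam) %/ e - (m * n) %/ e)%N *
   \prod_(1 <= i < (size lam).+1) rqint (m * n + i).
  rewrite (eq_bigr (fun i => qint (2 * (m * n + i)))); last by move=> i _;
    rewrite mulnDr mulnA.
  rewrite (eq_bigr _ (fun i _ => qint_double (m * n + i))) !big_split /=;
    congr (_ * _ * _).
    by rewrite prodr_const_nat subn1.
  by rewrite -sum_dvdn // -expr_sum.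
rewrite num (eq_bigr _ (fun j _ =>
  den j)) !big_split /= -!expr_sum -(size_count_mem lam_part).
move=> h; have nz : qintX 1 2 ^+ size lam != 0 by rewrite expf_neq0 // qintX_neq0.
by apply: (mulfI nz); rewrite [RHS]mulrA -h -!mulrA [LHS]mulrCA.
Qed.

Lemma mu_eval : (forall j, e %| c j)%N ->
  qeval (mu m n lam) * (N.-1`! * \prod_(1 <= j < B.+1) (c j %/ e)`!)%:R =
  ((N + size lam %/ e).-1`!)%:R.
Proof.
move=> dv; set L := (size lam %/ e)%N.
have LE : (\sum_(1 <= j < B.+1) c j %/ e = L)%N.
  rewrite /L (size_count_mem lam_part) [in RHS](eq_bigr (fun j => e * (c j %/ e))%N);
    last first.
    by move=> j _; rewrite mulnC divnK.
  by rewrite -big_distrr /= mulKn.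
have szE : size lam = (e * L)%N.
  by rewrite -LE big_distrr /= (size_count_mem lam_part); apply: eq_bigr => j _;
    rewrite mulnC divnK.
have := mu_reduced; rewrite LE.
(* [e] divides all multiplicities, hence l, so both exponents of [e]_(q^2) are L. *)
have -> : ((m * n + size lam) %/ e - (m * n) %/ e = L)%N.
  have -> : (m * n + size lam = m * n + L * e)%N by rewrite szE [(L * e)%N]mulnC.
  by rewrite divnDMl // addKn.
rewrite mulrAC [RHS]mulrC => /mulIf -/(_ (expf_neq0 _ (qintX_neq0 _ e_gt0))).
move/(congr1 qeval); rewrite qevalM !qeval_prod.
rewrite (eq_bigr (fun j => Bl ^+ (c j %/ e)%N * ((c j %/ e)`!)%N%:R)); last first.
  move=> j _; rewrite qeval_prod -prod_rho.
  by rewrite mulnC divnK.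
rewrite big_split /= -expr_sum LE.
have -> : \prod_(1 <= i < (size lam).+1) qeval (rqint (m * n + i)) =
   \prod_(e * N <= s < e * N + e * L) rho s.
  rewrite -[(e * N + _)%N]addnC -{1}[(e * N)%N]add0n big_addn addnK szE.
  by rewrite big_add1 /=; apply: eq_bigr => i _; rewrite eN addnS addnC -addnS.
rewrite prod_rho_shift mulrCA => /(mulfI (expf_neq0 _ Bl_neq0)) h.
rewrite natrM mulrCA natr_prod h -natr_prod -natrM; congr (_%:R).
(* (N - 1)! times N (N + 1) ... (N + L - 1) is (N + L - 1)!. *)
elim: (L) => [|k IH]; first by rewrite big_geq // muln1 addn0.
have Nk : (0 < N + k)%N by rewrite addn_gt0 N_gt0.
by rewrite big_nat_recr //= mulnA IH addnS /= -[in RHS](prednK Nk) factS (prednK Nk)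
  mulnC.
Qed.

(** Rounding c_j / e down loses something, so the numerator keeps at least one more factor [e]_(q^2)
    than the denominator, and this factor vanishes at [z]. *)
Lemma mu_eval0 j : ~~ (e %| c j)%N -> qeval (mu m n lam) = 0.
Proof.
move=> nd; have e1 : (1 < e)%N.
  by rewrite ltn_neqAle e_gt0 andbT; apply: contraNneq nd => <-; rewrite dvd1n.
have := mu_reduced; set a := (\sum_(1 <= j < B.+1) c j %/ e)%N; set b := (_ - _)%N.
have ab : (a < b)%N.
  have al : (e * a < size lam)%N.
    rewrite /a big_distrr /= (size_count_mem lam_part).
    have jB : j \in index_iota 1 B.+1.
      have jl : j \in lam.
        by rewrite -has_pred1 has_count lt0n; apply: contraNneq nd => ->; rewrite dvdn0.
      rewrite mem_index_iota ltnS (leq_bigmax_seq _ jl) // andbT lt0n.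
      by case/andP: lam_part => _; apply: contraNneq => <-.
    rewrite (bigD1_seq j) ?iota_uniq //= [in X in (_ < X)%N](bigD1_seq j) ?iota_uniq //=.
    rewrite -addSn leq_add //; last by apply: leq_sum => i _; rewrite mulnC leq_trunc_div.
    by rewrite mulnC ltn_neqAle leq_trunc_div andbT -dvdn_eq.
  (* e (N + a) = mn + 1 + e a <= mn + l, whereas the quotient of mn by e is below N; hence a < b. *)
  have h1 : (N + a <= (m * n + size lam) %/ e)%N.
    rewrite leq_divRL // mulnDl [(N * e)%N]mulnC eN [(a * e)%N]mulnC addSnnS.
    by rewrite leq_add2l.
  have h2 : ((m * n) %/ e < N)%N by rewrite ltn_divLR // [(N * e)%N]mulnC eN.
  by rewrite /b; move: h1 h2; clear; lia.
rewrite -(subnK (ltnW ab)) exprD mulrAC [RHS]mulrAC.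
move=> /(mulIf (expf_neq0 _ (qintX_neq0 _ e_gt0))) /(congr1 qeval).
rewrite !qevalM qeval_prod.
have -> : qeval (qintX 2 e ^+ (b - a)%N) = 0.
  rewrite -(subnSK ab) exprS qevalM qeval_qintXe // mul0r //.
rewrite mul0r => /eqP; rewrite mulf_eq0 => /orP[/eqP //|].
rewrite prodf_seq_eq0 => /hasP[i _ /=]; rewrite qeval_prod prodf_seq_eq0 => /hasP[s].
rewrite mem_index_iota => /andP[s0 _] /=.
by rewrite -/(rho s) (negbTE (rho_neq0 s0)).
Qed.
End RootEval.

(** * Orders of roots of unity and of rotations *)

Lemma unity_expX (R : realType) d k :
  unity_exp R d ^+ k = (cos (2 * pi / d%:R *+ k) +i* sin (2 * pi / d%:R *+ k))%C.
Proof.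
elim: k => [|k IH]; first by rewrite expr0 mulr0n cos0 sin0.
rewrite exprS IH /unity_exp; set t := 2 * pi / _; rewrite mulrS cosD sinD.
by apply/eqP; rewrite eq_complex /= eqxx addrC eqxx.
Qed.

(** For 0 < r < d the half angle x = pi r / d lies strictly between 0 and pi, so sin x > 0, whereas
    cos 2x = 1 would force cos x to have square 1. *)
Lemma unity_exp_eq1 (R : realType) d k : (0 < d)%N ->
  (unity_exp R d ^+ k == 1) = (d %| k)%N.
Proof.
move=> d0; have dn0 : d%:R != 0 :> R by rewrite pnatr_eq0 -lt0n.
have dp : 0 < d%:R :> R by rewrite ltr0n.
have one : unity_exp R d ^+ d = 1.
  rewrite unity_expX -[_ *+ d]mulr_natr divfK // mulr_natl cos2pi sin2pi.
  by apply/eqP; rewrite eq_complex /= !eqxx.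
have red : unity_exp R d ^+ k = unity_exp R d ^+ (k %% d).
  by rewrite {1}(divn_eq k d) exprD mulnC exprM one expr1n mul1r.
rewrite red /dvdn; have := ltn_mod k d; rewrite d0; move: (k %% d)%N => r rd.
case: (posnP r) => [->|r0]; first by rewrite expr0 eqxx.
apply/negbTE; rewrite unity_expX; set x := pi * (r%:R / d%:R) : R.
have -> : 2 * pi / d%:R *+ r = x *+ 2.
  rewrite /x -mulr_natr -[RHS]mulr_natl -!mulrA; congr (_ * (_ * _)).
  by rewrite mulrC.
have sx : 0 < sin x.
  have pi0 := pi_gt0 R; apply: sin_gt0_pi; rewrite /x mulr_gt0 ?divr_gt0 ?ltr0n //=.
  by rewrite gtr_pMr // ltr_pdivrMr // mul1r ltr_nat.
apply/eqP => /eqP; rewrite eq_complex /= => /andP[/eqP + _].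
rewrite cos_mulr2n => /eqP; rewrite subr_eq -mulr2n => /eqP h.
have : cos x ^+ 2 = 1.
  by apply: (mulIf (_ : 2 != 0 :> R)); rewrite ?pnatr_eq0 // !mulr_natr h.
have := cos2Dsin2 x => /[swap] ->; rewrite -[RHS]addr0 => /addrI/eqP.
by rewrite sqrf_eq0 (gt_eqF sx).
Qed.

Local Close Scope ring_scope.

Lemma dvdn_mul_divgcd (a b k : nat) : 0 < b -> (b %| a * k) = (b %/ gcdn a b %| k).
Proof.
move=> b_gt0; have N_gt0 : 0 < gcdn a b by rewrite gcdn_gt0 b_gt0 orbT.
have eb := divnK (dvdn_gcdr a b); have ea := divnK (dvdn_gcdl a b).
have co : coprime (b %/ gcdn a b) (a %/ gcdn a b).
  by rewrite /coprime -(eqn_pmul2r N_gt0) muln_gcdl eb ea mul1n gcdnC.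
by rewrite -[RHS](Gauss_dvdr _ co) -[RHS](dvdn_pmul2r N_gt0) eb mulnAC ea.
Qed.

(** In other words, the square of a root of unity of order [#[g]] has order H / gcd(g, H), the
    number called e above. *)
Lemma order_vertex_dvd (m n k : nat) (g : vertex m n) :
  (#[g]%g %| 2 * k) = (halfgon m n %/ gcdn g (halfgon m n) %| k).
Proof.
have -> : (#[g]%g %| 2 * k) = (2 * halfgon m n %| g * (2 * k)).
  rewrite order_dvdn Zp_expg -val_eqE /= /dvdn.
  by rewrite -cardV.
by rewrite mulnCA dvdn_pmul2l // dvdn_mul_divgcd.
Qed.

Theorem theorem6p7 (R : realType) (m n : nat) (lam : seq nat)
    (m_ge1 : (1 <= m)%N) (n_ge1 : (1 <= n)%N)
    (lam_part : is_partition lam) (lam_le : (sumn lam <= n)%N) :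
  exhibits_CSP R (rotation m n) (faces_of_type m n lam)
    [set: vertex m n]%G (mu m n lam).
Proof.
have lam2n : all (fun j => j <= 2 * n) lam by exact: all_leq_double lam_le.
split; first by apply/cyclicP; exists Zp1; apply: Zp_cycle.
  apply/actsP => g _ f; apply/idP/idP => [|fX]; last exact: faces_rotation.
  move/(faces_rotation m_ge1 n_ge1 (g^-1)%g lam_part lam2n).
  by rewrite actK.
move=> g _; set H := halfgon m n; set N := gcdn g H; set e := H %/ N.
have H_gt0 : 0 < H by [].
have e_gt0 : 0 < e by rewrite divn_gt0 ?gcdn_gt0 ?H_gt0 ?orbT // dvdn_leq ?dvdn_gcdr.
have eN : e * N = (m * n).+1 by rewrite divnK ?dvdn_gcdr.
have zX k : (unity_exp R #[g]%g ^+ (2 * k) == 1)%R = (e %| k).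
  by rewrite unity_exp_eq1 ?order_gt0 // order_vertex_dvd.
rewrite -[LHS]/(qeval _ _).
have [/allP dv | /allPn[j _ nd]] := boolP (all (fun j => e %| count_mem j lam) lam);
  last first.
  by rewrite (mu_eval0 e_gt0 zX lam_part eN nd) (card_fixed_eq0 m_ge1 n_ge1 lam_part
    lam_le nd).
have {}dv j : e %| count_mem j lam.
  by have [/dv //|/count_memPn ->] := boolP (j \in lam); rewrite dvdn0.
(* The value of [mu] and the number of fixed faces have the same product with the same nonzero
   factorials. *)
have := mu_eval e_gt0 zX lam_part eN dv.
rewrite -(card_fixed m_ge1 n_ge1 lam_part lam_le dv) [RHS]natrM.
apply: mulIf.
rewrite pnatr_eq0 -lt0n muln_gt0 fact_gt0 /=.
by apply: prodn_gt0 => j; apply: fact_gt0.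
Qed.
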